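(* In Problem P1 or Problem P2 modified so that O1 can send one of $M$ possible final messages $\{0,1,\dots,M-1\}$, there is no loss of optimality in restricting attention to policies for O1 that are of the form $$Z^1_{T^1}=\begin{cases} M-1 & \text{if } \pi^1_{T^1}\le\alpha^{M-1}_{T^1}\\ M-2 & \text{if } \alpha^{M-1}_{T^1}<\pi^1_{T^1}\le\alpha^{M-2}_{T^1}\\ \ \vdots\\ 1&\text{if } \alpha^2_{T^1}<\pi^1_{T^1}\le\alpha^1_{T^1}\\ 0&\text{if } \pi^1_{T^1}>\alpha^1_{T^1}\end{cases}$$ where $0\le\alpha^{M-1}_{T^1}\le\alpha^{M-2}_{T^1}\le\dots\le\alpha^1_{T^1}\le1$ are $M-1$ thresholds, and for $k=1,2,\dots,T^1-1$, $$Z^1_k=\begin{cases} b&\text{if } \pi^1_k<\alpha^{M-1}_k\\ M-1&\text{if } \alpha^{M-1}_k\le\pi^1_k\le\beta^{M-1}_k\\ b&\text{if } \beta^{M-1}_k<\pi^1_k<\alpha^{M-2}_k\\ M-2&\text{if } \alpha^{M-2}_k\le\pi^1_k\le\beta^{M-2}_k\\ \ \vdots\\ 1&\text{if } \alpha^1_k\le\pi^1_k\le\beta^1_k\\ b&\text{if } \beta^1_k<\pi^1_k<\alpha^0_k\\ 0&\text{if } \alpha^0_k\le\pi^1_k\le\beta^0_k\\ b&\text{if } \pi^1_k>\beta^0_k\end{cases}$$ where $0\le\alpha^{M-1}_k\le\beta^{M-1}_k\le\alpha^{M-2}_k\le\dots\le\alpha^1_k\le\beta^1_k\le\alpha^0_k\le\beta^0_k\le1$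 are $2M$ thresholds. (No loss of optimality: for every pair of policies of O1 and O2 there is a pair with O1's policy of this form and no larger expected cost.)
   Context: **Model.** $H\in\{0,1\}$ is random with known prior $P(H=0)=p_0$, $P(H=1)=1-p_0$. There are two observers O1, O2. $Y^i_t\in\mathcal{Y}^i$ is the observation of O$i$ at time $t$; given $H$, it has either a discrete distribution $P^i_t(\cdot|H)$ or a density $f^i_t(\cdot|H)$. Given $H$, the observations of each observer at different times are independent, and the two observation sequences are independent. $X_{1:t}$ denotes $X_1,\dots,X_t$; $b$ is a blank message (no transmission). **O1.** As long as it has not sent a final message, at time $t$ O1 chooses $Z^1_t=\gamma^1_t(Y^1_{1:t})\in\{0,1,\dots,M-1,b\}$; $\tau^1=\min\{t: Z^1_t\in\{0,1,\dots,M-1\}\}\le T^1<\infty$ (at time $T^1$ it must send a final message if it has not done so before). A policy is $\Gamma^1=(\gamma^1_1,\dots,\gamma^1_{T^1})$. It sends nothing afterwards and gets no feedback from O2. O1's belief is $\pi^1_t=P(H=0|Y^1_{1:t})$. **Problem P1.** O2 waits for O1's final message and only then takes its own measurements: after $k=0,1,2,\dots$ measurements it chooses $U^2_k=\gamma^2_k(Y^2_{1:k},Z^1_{1:\tau^1})\in\{0,1,N\}$ ($N$ = continue); $\tau^2=\min\{k:U^2_k\in\{0,1\}\}\le T^2<\infty$. A policy is $\Gamma^2=(\gamma^2_0,\dots,\gamma^2_{T^2})$. **Problem P2.** O2 takes measurements from time $t=1$; at each time $t$, after O1's action at time $t$, O2 chooses $U^2_t=\gamma^2_t(Y^2_{1:t},Z^1_{1:t})\in\{0,1,N\}$,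 where for $t>\tau^1$ the sequence $Z^1_{1:t}$ means $Z^1_{1:\tau^1}$; $\tau^2=\min\{t:U^2_t\in\{0,1\}\}\le T^2$, $T^1\le T^2<\infty$. O2 may stop before O1 does. A policy is $\Gamma^2=(\gamma^2_1,\dots,\gamma^2_{T^2})$. **Objective (both problems).** Minimize $\mathbb{E}^{\Gamma^1,\Gamma^2}\{c^1\tau^1+c^2\tau^2+J(U^2_{\tau^2},H)\}$, where $c^1,c^2$ are finite positive numbers, $0\le J\le L<\infty$, $J(0,1)>J(1,1)$, $J(1,0)>J(0,0)$. **Convention.** If a point belongs to several cases of the rule at time $k$ (only possible when thresholds coincide), the first listed applicable case is used. *)

(* Defs.v *)
From HB Require Import structures.
From mathcomp Require Import all_boot all_order all_algebra.
From mathcomp Require Import all_classical all_reals all_analysis.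
Set Implicit Arguments.
Unset Strict Implicit.
Unset Printing Implicit Defensive.
Import Order.TTheory GRing.Theory Num.Theory.
Import numFieldNormedType.Exports.
Local Open Scope classical_set_scope.
Local Open Scope ring_scope.

(* The hypothesis H and the final decisions of O2, valued in {0,1}, are encoded
   as booleans with [false] for 0 and [true] for 1.  An action of O1 is
   [Some m] for the final message m and [None] for the blank message b; an
   action of O2 is [Some u] for the final decision u and [None] for N. *)

Inductive problem := P1 | P2.

Section Model.
Context {R : realType} {dW : measure_display} {Omega : measurableType dW}.
Variable P : probability Omega R.

(* Observations are indexed by times t >= 1; [Y 0] is never used. *)
Definition history {d} {Obs : measurableType d} (Y : nat -> {RV P >-> Obs})
    (t : nat) (w : Omega) : t.-tuple Obs :=
  [tuple Y i.+1 w | i < t].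

(* Probability density with respect to a sigma-finite reference measure: a
   counting measure gives the discrete case (f is then the mass function),
   Lebesgue measure the case of an ordinary density. *)
Definition is_density {d} {Obs : measurableType d}
    (mu : {sigma_finite_measure set Obs -> \bar R}) (f : Obs -> R) : Prop :=
  [/\ measurable_fun setT f, forall y, 0 <= f y
    & (\int[mu]_y (f y)%:E = 1)%E].

(* Given H = h, all observations of both observers are independent, with
   densities [f1 t h] and [f2 t h] at time t; written without division by
   P(H = h), so that nothing is required when P(H = h) = 0. *)
Definition cond_independent_with_densities {d1 d2}
    {Obs1 : measurableType d1} {Obs2 : measurableType d2}
    (H : {RV P >-> bool})
    (Y1 : nat -> {RV P >-> Obs1}) (Y2 : nat -> {RV P >-> Obs2})
    (mu1 : nat -> {sigma_finite_measure set Obs1 -> \bar R})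
    (mu2 : nat -> {sigma_finite_measure set Obs2 -> \bar R})
    (f1 : nat -> bool -> Obs1 -> R) (f2 : nat -> bool -> Obs2 -> R) : Prop :=
  forall (h : bool) (n1 n2 : nat) (A : 'I_n1 -> set Obs1) (B : 'I_n2 -> set Obs2),
    (forall i, measurable (A i)) -> (forall j, measurable (B j)) ->
    (P [set w | [/\ H w = h, forall i, A i (Y1 i.+1 w)
                  & forall j, B j (Y2 j.+1 w)]]
     = P [set w | H w = h]
       * (\prod_(i < n1) \int[mu1 i.+1]_(y in A i) (f1 i.+1 h y)%:E)
       * (\prod_(j < n2) \int[mu2 j.+1]_(y in B j) (f2 j.+1 h y)%:E))%E.

(* [pi] is a version of the conditional probability P(H = 0 | Y_{1:t}), as a
   function of the observed values. *)
Definition is_belief {d} {Obs : measurableType d} (H : {RV P >-> bool})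
    (Y : nat -> {RV P >-> Obs}) (t : nat) (pi : t.-tuple Obs -> R) : Prop :=
  measurable_fun setT pi /\
  forall A : set (t.-tuple Obs), measurable A ->
    P ([set w | H w = false] `&` history Y t @^-1` A)
    = (\int[P]_(w in history Y t @^-1` A) (pi (history Y t w))%:E)%E.

End Model.

Section Policies.
Context {d1 d2 : measure_display}.
Context {Obs1 : measurableType d1} {Obs2 : measurableType d2}.
Variable M : nat.

(* gamma^1_t (Y^1_{1:t}) and gamma^2_t (Y^2_{1:t}, z), z being the sequence of
   messages received from O1.  The values prescribed after the final action
   has been taken are immaterial. *)
Definition policy1 := forall t, t.-tuple Obs1 -> option 'I_M.
Definition policy2 := forall t, t.-tuple Obs2 -> seq (option 'I_M) -> option bool.

Definition admissible1 (T1 : nat) (g1 : policy1) : Prop :=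
  (forall t a, measurable [set y | g1 t y = a]) /\
  forall y, g1 T1 y <> None.

Definition admissible2 (T2 : nat) (g2 : policy2) : Prop :=
  (forall t z a, measurable [set y | g2 t y z = a]) /\
  forall y z, g2 T2 y z <> None.

End Policies.
Arguments policy1 {d1} Obs1 M.
Arguments policy2 {d2} Obs2 M.

(* The least t with s <= t <= T and p t (T if there is none). *)
Definition first_time (s T : nat) (p : pred nat) : nat :=
  [arg min_(t < (ord_max : 'I_T.+1) | (s <= t)%N && p t) (t : nat)].

Section Cost.
Context {R : realType} {dW d1 d2 : measure_display}.
Context {Omega : measurableType dW}.
Context {Obs1 : measurableType d1} {Obs2 : measurableType d2}.
Variables (P : probability Omega R) (H : {RV P >-> bool}).
Variables (Y1 : nat -> {RV P >-> Obs1}) (Y2 : nat -> {RV P >-> Obs2}).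
Variables (prob : problem) (M T1 T2 : nat).
Variables (g1 : policy1 Obs1 M) (g2 : policy2 Obs2 M).

Definition message (w : Omega) (t : nat) : option 'I_M :=
  g1 (history Y1 t w).

Definition tau1 (w : Omega) : nat := first_time 1 T1 (fun t => isSome (message w t)).

Definition messages (w : Omega) (t : nat) : seq (option 'I_M) :=
  [seq message w s | s <- iota 1 t].

Definition received (w : Omega) (t : nat) : seq (option 'I_M) :=
  match prob with
  | P1 => messages w (tau1 w)
  | P2 => messages w (minn t (tau1 w))
  end.

Definition decision (w : Omega) (t : nat) : option bool :=
  g2 (history Y2 t w) (received w t).

Definition tau2 (w : Omega) : nat :=
  first_time (match prob with P1 => 0 | P2 => 1 end) T2
    (fun t => isSome (decision w t)).

Variables (c1 c2 : R) (J : bool -> bool -> R).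

(* For an admissible [g2] the decision at time [tau2] is never [None]. *)
Definition total_cost (w : Omega) : R :=
  c1 * (tau1 w)%:R + c2 * (tau2 w)%:R
  + (if decision w (tau2 w) is Some u then J u (H w) else 0).

Definition expected_cost : \bar R := ('E_P[total_cost])%E.

End Cost.

Section Thresholds.
Context {R : realType}.
Variable M : nat.

(* The action of the first case whose condition holds. *)
Definition first_case (cases : seq (bool * option 'I_M)) : option 'I_M :=
  oapp snd None (ohead [seq c <- cases | c.1]).

(* Messages are listed from M-1 down to 0; [insub m : option 'I_M] is [Some] of
   the message m, as m < M.  When M = 1 there is no threshold at the final time
   and message 0 is always sent. *)
Definition final_rule (alpha : nat -> R) (pi : R) : option 'I_M :=
  first_case
    (rcons
      [seq (((m == M.-1) || (alpha m.+1 < pi)) && (pi <= alpha m), insub m)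
        | m <- rev (iota 1 M.-1)]
      ((M == 1%N) || (alpha 1%N < pi), insub 0%N)).

Definition final_thresholds (alpha : nat -> R) : Prop :=
  sorted <=%R (0 :: rcons [seq alpha m | m <- rev (iota 1 M.-1)] 1).

Definition stage_rule (alpha beta : nat -> R) (pi : R) : option 'I_M :=
  first_case
    ((pi < alpha M.-1, None)
     :: flatten [seq [:: (alpha m <= pi <= beta m, insub m);
                         (beta m < pi < alpha m.-1, None)]
                  | m <- rev (iota 1 M.-1)]
     ++ [:: (alpha 0%N <= pi <= beta 0%N, insub 0%N);
            (beta 0%N < pi, None)]).

Definition stage_thresholds (alpha beta : nat -> R) : Prop :=
  sorted <=%R
    (0 :: rcons (flatten [seq [:: alpha m; beta m] | m <- rev (iota 0 M)]) 1).

(* [alpha k m] and [beta k m] are the thresholds for message m at time k. *)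
Definition threshold_policy {d} {Obs : measurableType d} (T1 : nat)
    (pi : forall t, t.-tuple Obs -> R) (g1 : policy1 Obs M) : Prop :=
  exists alpha beta : nat -> nat -> R,
    [/\ final_thresholds (alpha T1),
        forall y, g1 T1 y = final_rule (alpha T1) (pi T1 y),
        forall k, (1 <= k < T1)%N -> stage_thresholds (alpha k) (beta k)
      & forall k, (1 <= k < T1)%N ->
          forall y, g1 k y = stage_rule (alpha k) (beta k) (pi k y)].

End Thresholds.

(* Main.v *)
Require Import Defs.
From HB Require Import structures.
From mathcomp Require Import all_boot all_order all_algebra.
From mathcomp Require Import all_classical all_reals all_analysis.
From mathcomp Require Import measurable_realfun ring lra.
Set Implicit Arguments.
Unset Strict Implicit.
Unset Printing Implicit Defensive.
Import Order.TTheory GRing.Theory Num.Theory.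
Import numFieldNormedType.Exports.
Local Open Scope classical_set_scope.
Local Open Scope ring_scope.

(** Fix the policy of O2.  Given H, the observations of O1 and of O2 are
    independent, so the expected cost is a sum over the hypothesis h, the
    stopping time k and the message m of O1, weighted by the probability of
    (h, k, m) and by a cost that depends only on h, k, m ([expected_costE]): O2
    may be averaged out.  What remains is an optimal stopping problem for O1.

    In that problem, sending m at time k with belief x costs a linear function
    of x.  Dynamic programming gives the cost of continuing as a function of the
    belief alone, and this function is concave.  Both facts are easiest to see
    for unnormalised weights (a, b) of the two hypotheses in place of (x, 1 - x):
    an observation y multiplies the weights by its two densities, the value is
    positively homogeneous in the weights, and the continuation cost is the
    integral over y of the next value at the updated weights
    ([bayes_step], [regular_trans], [belief_step]).  Concavity and a Lipschitz
    bound pass through the integral and through minima.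

    The beliefs at which message m is optimal form a sublevel set of a linear
    function minus a concave one, hence a closed interval ([sublevel_interval]).
    Two messages whose lines have different slopes have intervals that lie side
    by side, the larger slope on the left, so the optimal messages can be listed
    from left to right ([optimal_chain]).  This order depends on the time, but
    O2 knows when a message was sent: O1 may relabel its messages at each time
    and O2 may translate them back ([mimics], [mimic_exists]).

    Two points need care.  Messages that are optimal nowhere must still receive
    an interval: they repeat the last optimal message on a single point.  And at
    a time when no message at all is optimal, the prescribed form forces a
    transmission at one belief at least.  Belief 0 is chosen: H = 1 is then
    certain, observing on is pointless, and the optimal cost is that of some
    message m' at some later time k' ([value_false]).  O1 announces (k', m')
    immediately and O2 behaves as if O1 had stayed silent until k' and sent m'
    then; only O1's cost of waiting changes, and it decreases ([stage_plan]).

    The comparison of costs is by backward induction: no policy of O1 has a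
    smaller cost than the value ([value_le_cost]), and the threshold policy with
    relabelled messages has at most that cost ([cost_le_value]). *)

(** * Threshold rules *)

Section ThresholdRules.
Context {R : realType} {M : nat}.
Hypothesis M_gt0 : (0 < M)%N.
Implicit Types (alpha beta : nat -> R) (x : R).

Lemma first_case_cons (c : bool * option 'I_M) cs :
  first_case (c :: cs) = if c.1 then c.2 else first_case cs.
Proof. by rewrite /first_case /=; case: c => -[]. Qed.

Lemma first_caseP (cs : seq (bool * option 'I_M)) :
  (exists2 c, c \in cs & c.1 /\ first_case cs = c.2) \/
  (first_case cs = None /\ {in cs, forall c, ~~ c.1}).
Proof.
elim: cs => [|c cs IH]; first by right.
rewrite first_case_cons; case: ifP => c1.
  by left; exists c; rewrite ?mem_head.
case: IH => [[d dcs d1]|[-> all0]]; [left|right].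
  by exists d => //; rewrite in_cons dcs orbT.
by split=> // d; rewrite in_cons => /predU1P[->|/all0//]; rewrite c1.
Qed.

(** Message M-1 is meant for the smallest beliefs, so the intervals move to the
    left as the index of the message grows. *)
Definition chained alpha beta : Prop :=
  [/\ forall m, (m < M)%N -> alpha m <= beta m,
      forall i j, (i < j)%N -> (j < M)%N -> beta j <= alpha i,
      0 <= alpha M.-1 & beta 0%N <= 1].

Lemma chained_sorted alpha beta :
  chained alpha beta -> stage_thresholds M alpha beta.
Proof.
move=> [ab ba a0 b1]; rewrite /stage_thresholds /=.
have bnd m : (m < M)%N -> beta m <= 1.
  case: m => [//|m] mM; apply: le_trans (ba _ _ (ltn0Sn m) mM) _.
  exact: le_trans (ab _ M_gt0) b1.
suff chain n x : (n <= M)%N -> x <= 1 -> ((0 < n)%N -> x <= alpha n.-1) ->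
    path <=%R x (rcons (flatten
      [seq [:: alpha m; beta m] | m <- rev (iota 0 n)]) 1).
  exact: chain.
elim: n x => [|n IH] x nM x1 xa; first by rewrite /= x1.
rewrite -[n.+1]addn1 iotaD cats1 rev_rcons /= add0n xa //= ab //=.
apply: IH; [exact: ltnW|exact: bnd|case: n nM {xa} => [//|n] nM _].
exact: ba.
Qed.

Lemma chained_final_sorted alpha beta :
  chained alpha beta -> final_thresholds M beta.
Proof.
move=> [ab ba a0 b1]; rewrite /final_thresholds /=.
have bb i j : (i <= j)%N -> (j < M)%N -> beta j <= beta i.
  rewrite leq_eqVlt => /predU1P[->//|ij jM].
  exact: le_trans (ba _ _ ij jM) (ab _ (ltn_trans ij jM)).
suff chain n x : (n < M)%N -> x <= beta n ->
    path <=%R x (rcons [seq beta m | m <- rev (iota 1 n)] 1).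
  apply: chain; first by rewrite ltn_predL.
  by apply: le_trans (a0) _; apply: ab; rewrite ltn_predL.
elim: n x => [|n IH] x nM xb; first by rewrite /= andbT (le_trans xb).
rewrite -[n.+1]addn1 iotaD cats1 rev_rcons /= add1n xb /=.
by apply: IH; [exact: ltnW|exact: bb].
Qed.

Let insubE m : (m < M)%N -> exists2 j : 'I_M, (insub m : option 'I_M) = Some j & m = j.
Proof. by move=> mM; exists (Ordinal mM); rewrite // insubT. Qed.

Let mem_iota1 (m : nat) : (m \in rev (iota 1 M.-1)) = (0 < m < M)%N.
Proof. by rewrite mem_rev mem_iota add1n prednK. Qed.

Let ord_le (j : 'I_M) : (j <= M.-1)%N.
Proof. by rewrite -ltnS prednK. Qed.

(** Only membership is claimed: an end-point shared by two intervals may go to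
    either of them. *)
Lemma stage_ruleP alpha beta x : chained alpha beta ->
  match stage_rule M alpha beta x return Prop with
  | Some j => alpha j <= x <= beta j
  | None => forall j : 'I_M, ~~ (alpha j <= x <= beta j)
  end.
Proof.
move=> [ab ba _ _].
have gap (m : nat) (j : 'I_M) : (0 < m < M)%N -> beta m < x < alpha m.-1 ->
    ~~ (alpha j <= x <= beta j).
  move=> /andP[m0 mM] /andP[bx xa]; apply/negP => /andP[ax xb].
  have [mj|jm] := leqP m j.
    have : beta j <= beta m.
      move: mj; rewrite leq_eqVlt => /predU1P[->//|mj].
      exact: le_trans (ba _ _ mj (ltn_ord j)) (ab _ mM).
    by move=> /(le_trans xb) /le_lt_trans /(_ bx); rewrite ltxx.
  have : alpha m.-1 <= alpha j.
    move: jm; rewrite -[in X in X -> _](prednK m0) ltnS leq_eqVlt.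
    move=> /predU1P[->//|jm]; apply: le_trans (ba _ _ jm _).
      by apply: ab; rewrite (leq_ltn_trans _ mM)// leq_pred.
    by rewrite (leq_ltn_trans _ mM)// leq_pred.
  by move=> /le_trans /(_ ax) /le_lt_trans /(_ xa); rewrite ltxx.
have below (j : 'I_M) : x < alpha M.-1 -> ~~ (alpha j <= x <= beta j).
  move=> xa; apply/negP => /andP[ax _].
  suff /le_trans /(_ ax) /le_lt_trans /(_ xa) : alpha M.-1 <= alpha j.
    by rewrite ltxx.
  have := ord_le j; rewrite leq_eqVlt => /predU1P[->//|jM]; apply: le_trans (ba _ _ jM _).
    by apply: ab; rewrite ltn_predL.
  by rewrite ltn_predL.
have above (j : 'I_M) : beta 0%N < x -> ~~ (alpha j <= x <= beta j).
  move=> bx; apply/negP => /andP[_ xb].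
  suff /(le_trans xb) /le_lt_trans /(_ bx) : beta j <= beta 0%N.
    by rewrite ltxx.
  case: (posnP j) => [->//|j0].
  exact: le_trans (ba _ _ j0 (ltn_ord j)) (ab _ M_gt0).
rewrite /stage_rule.
set cs := _ :: _.
have inside m : (m < M)%N -> (alpha m <= x <= beta m, insub m) \in cs.
  move=> mM; rewrite inE mem_cat; case: (posnP m) => [->|m0].
    by rewrite !inE eqxx !orbT.
  apply/orP; right; apply/orP; left; apply/flattenP.
  exists [:: (alpha m <= x <= beta m, insub m); (beta m < x < alpha m.-1, None)].
    by apply/mapP; exists m; rewrite // mem_iota1 m0.
  exact: mem_head.
case: (first_caseP cs) => [[c ccs [c1 ->]]|[-> all0] j]; last first.
  exact: all0 (inside _ (ltn_ord j)).
move: ccs; rewrite inE mem_cat => /predU1P[cE|/orP[|]].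
- by move: c1; rewrite cE /= => xa j; exact: below.
- move=> /flattenP[s /mapP[m]]; rewrite mem_iota1 => mM ->.
  rewrite !inE => /orP[/eqP cE|/eqP cE]; move: c1; rewrite cE /=.
    by case/andP: mM => _ /insubE[j -> ->].
  by move=> xg j; exact: gap xg.
- rewrite !inE => /orP[/eqP cE|/eqP cE]; move: c1; rewrite cE /=.
    by case: (insubE M_gt0) => j -> <-.
  by move=> bx j; exact: above.
Qed.

(** This holds for beliefs outside [0, 1] too: a version of the belief may take
    such values on a null set, and the final message is due even then. *)
Lemma final_rule_some beta x : exists j : 'I_M,
  [/\ final_rule M beta x = Some j, (j == M.-1 :> nat) || (beta j.+1 < x)
    & (j == 0 :> nat)%N || (x <= beta j)].
Proof.
rewrite /final_rule; set cs := rcons _ _.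
have c0 : ((M == 1%N) || (beta 1%N < x), insub 0%N) \in cs.
  by rewrite mem_rcons mem_head.
have cm m : (0 < m < M)%N -> (((m == M.-1) || (beta m.+1 < x)) &&
   (x <= beta m), insub m) \in cs.
  move=> mM; rewrite mem_rcons inE; apply/orP; right.
  by apply/mapP; exists m => //; rewrite mem_iota1.
case: (first_caseP cs) => [[c ccs [c1 ->]]|[_ all0]].
  move: ccs; rewrite mem_rcons inE => /predU1P[cE|/mapP[m]].
    move: c1; rewrite cE /= => c1.
    case: (insubE M_gt0) => j -> jE; exists j; split=> //; rewrite -jE //.
    by rewrite -subn1 eq_sym subn_eq0 leq_eqVlt ltnS leqn0 (gtn_eqF M_gt0) orbF.
  rewrite mem_iota1 => /andP[m0 mM] cE.
  move: c1; rewrite cE /= => /andP[lo hi].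
  by case: (insubE mM) => j -> jE; exists j; rewrite -jE lo hi orbT.
exfalso.
(* If every case fails, x exceeds all thresholds. *)
have nlt m : (0 < m)%N -> (m < M)%N -> x <= beta m -> False.
  move=> m0 mM; move Ed : (M.-1 - m)%N => d.
  elim: d m Ed m0 mM => [|d IH] m Ed m0 mM xb.
    have mE : m = M.-1.
      by apply/eqP; rewrite eqn_leq -subn_eq0 subn_eq0 -ltnS prednK // mM
        -subn_eq0 Ed.
    by have := all0 _ (cm m _); rewrite m0 mM /= mE eqxx -mE xb => /(_ isT).
  have m1M : (m.+1 < M)%N.
    by rewrite -[M]prednK // ltnS -subn_gt0 Ed.
  have := all0 _ (cm m _); rewrite m0 mM /= xb andbT => /(_ isT).
  rewrite negb_or -leNgt => /andP[_]; apply: IH => //.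
  by rewrite subnS Ed.
have := all0 _ c0; rewrite /= negb_or -leNgt => /andP[M1 x1].
by apply: nlt x1 => //; rewrite ltn_neqAle eq_sym M1.
Qed.

(** Taking the right end-points of a chain of intervals that covers [x] as the
    final thresholds sends [x] to an interval containing it: at a common
    end-point of two intervals either message will do. *)
Lemma final_ruleP alpha beta x : chained alpha beta ->
  (exists i : 'I_M, alpha i <= x <= beta i) ->
  exists2 j, final_rule M beta x = Some j & alpha j <= x <= beta j.
Proof.
move=> [ab ba _ _] [i xi]; have [j [jE lo hi]] := final_rule_some beta x.
exists j => //; have jM := ltn_ord j.
have [ij|ji|<-//] := ltngtP i j.
  have xb : x <= beta j by case/orP: hi => // /eqP j0; rewrite j0 in ij.
  have bi : beta j <= alpha i by exact: ba.
  case/andP: xi => ax _; rewrite xb andbT.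
  by rewrite (le_trans (ab j jM)) ?(le_trans bi).
exfalso; case/orP: lo => [/eqP jl|bx].
  by move: ji; rewrite jl ltnNge ord_le.
case/andP: xi => _ xb.
have : beta i <= beta j.+1.
  move: ji; rewrite leq_eqVlt => /predU1P[->//|ji].
  apply: le_trans (ba _ _ ji (ltn_ord i)) (ab _ _).
  exact: ltn_trans ji (ltn_ord i).
by move=> /(le_trans xb) /le_lt_trans /(_ bx); rewrite ltxx.
Qed.

(** * Measurability of the threshold rules *)

Let case_measurable (cs : R -> seq (bool * option 'I_M)) : Prop :=
  forall a, measurable [set x | first_case (cs x) = a].

Let case_cons (b : R -> bool) v cs : measurable [set x | b x] ->
  case_measurable cs -> case_measurable (fun x => (b x, v) :: cs x).
Proof.
move=> mb mcs a.
have -> : [set x | first_case ((b x, v) :: cs x) = a] =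
    ([set x | b x] `&` [set _ | v = a]) `|`
    (~` [set x | b x] `&` [set x | first_case (cs x) = a]).
  apply/seteqP; split=> x; rewrite /= first_case_cons /=.
    by case: ifP => bx va; [left|right; split=> //; rewrite bx].
  by case=> [[-> ->]//|[/negP/negbTE -> ->]].
apply: measurableU.
  apply: measurableI => //; have [->|va] := pselect (v = a).
    by rewrite (_ : [set _ | _] = setT) //; apply/seteqP; split.
  by rewrite (_ : [set _ | _] = set0) //; apply/seteqP; split.
by apply: measurableI => //; exact: measurableC.
Qed.

Let case_nil : case_measurable (fun=> [::]).
Proof.
move=> a; rewrite /first_case /=; have [->|a0] := pselect (a = None).
  by rewrite (_ : [set _ | _] = setT) //; apply/seteqP; split.
by rewrite (_ : [set _ | _] = set0) //; apply/seteqP; split=> // x /esym.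
Qed.

Let measurable_lt (c : R) : measurable [set x | x < c].
Proof.
by rewrite (_ : [set _ | _] = `]-oo, c[%classic) //; apply/seteqP; split=> x /=;
  rewrite in_itv.
Qed.

Let measurable_gt (c : R) : measurable [set x | c < x].
Proof.
by rewrite (_ : [set _ | _] = `]c, +oo[%classic) //; apply/seteqP; split=> x /=;
  rewrite in_itv /= andbT.
Qed.

Let measurable_ge (c : R) : measurable [set x | c <= x].
Proof.
rewrite (_ : [set _ | _] = ~` [set x | x < c]); first exact: measurableC.
by apply/seteqP; split=> x /=; rewrite leNgt => /negP.
Qed.

Let measurable_le (c : R) : measurable [set x | x <= c].
Proof.
rewrite (_ : [set _ | _] = ~` [set x | c < x]); first exact: measurableC.
by apply/seteqP; split=> x /=; rewrite leNgt => /negP.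
Qed.

Let measurable_and (b b' : R -> bool) : measurable [set x | b x] ->
  measurable [set x | b' x] -> measurable [set x | b x && b' x].
Proof.
move=> mb mb'; rewrite (_ : [set _ | _] = [set x | b x] `&` [set x | b' x]).
  exact: measurableI.
by apply/seteqP; split=> x /=; [move/andP|case=> -> ->].
Qed.

Let measurable_orb c (b : R -> bool) : measurable [set x | b x] ->
  measurable [set x | c || b x].
Proof.
by case: c => //= _; rewrite (_ : [set _ | _] = setT) //; apply/seteqP; split.
Qed.

Lemma measurable_stage_rule alpha beta a :
  measurable [set x | stage_rule M alpha beta x = a].
Proof.
move: a; apply: case_cons => //.
elim: (rev _) => [|m s IH].
  apply: case_cons; first exact: measurable_and.
  by apply: case_cons => //; exact: case_nil.
apply: case_cons; first exact: measurable_and.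
by apply: case_cons IH; exact: measurable_and.
Qed.

Lemma measurable_final_rule beta a :
  measurable [set x | final_rule M beta x = a].
Proof.
move: a; rewrite /final_rule; elim: (rev _) => [|m s IH].
  by apply: case_cons case_nil; exact: measurable_orb.
by apply: case_cons IH; apply: measurable_and => //; exact: measurable_orb.
Qed.

End ThresholdRules.

(** * Intervals on which a linear function is below a concave one *)

Section Intervals.
Context {R : realType}.

(** Quasi-convexity makes the sublevel set an interval.  The Lipschitz bound
    makes it closed; continuity in the interior of [0, 1] would not suffice, as a
    concave function may jump at 0 and at 1. *)
Lemma sublevel_interval (F : R -> R) (K : R) :
  (forall x y : R, 0 <= x <= 1 -> 0 <= y <= 1 -> F x <= F y + K * `|x - y|) ->
  (forall x y z : R, 0 <= x -> y <= 1 -> x <= z <= y ->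
     F x <= 0 -> F y <= 0 -> F z <= 0) ->
  (exists2 x : R, 0 <= x <= 1 & F x <= 0) ->
  exists lo hi : R, [/\ 0 <= lo, lo <= hi, hi <= 1 &
    forall x : R, 0 <= x <= 1 -> (F x <= 0) = (lo <= x <= hi)].
Proof.
move=> Flip Fq [x0 x01 Fx0].
pose S : set R := [set x | 0 <= x <= 1 /\ F x <= 0].
have S0 : S !=set0 by exists x0.
have supS : has_sup S by split=> //; exists 1 => x [/andP[]].
have infS : has_inf S by split=> //; exists 0 => x [/andP[]].
have close (s : R) : 0 <= s <= 1 ->
    (forall e, 0 < e -> exists2 x, S x & `|s - x| <= e) -> F s <= 0.
  move=> s01 near; apply/ler_addgt0Pr => e e0; rewrite add0r.
  have K0 : 0 < `|K| + 1 by rewrite ltr_wpDl.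
  have [x [x01' Fx] sx] := near (e / (`|K| + 1)) (divr_gt0 e0 K0).
  apply: le_trans (Flip _ _ s01 x01') _.
  rewrite -[leRHS]add0r lerD // (le_trans (ler_norm _)) // normrM normr_id.
  rewrite (le_trans (ler_wpM2l _ sx)) // mulrA ler_pdivrMr // mulrC.
  by rewrite ler_wpM2l ?(ltW e0) // lerDl.
have hi_ge : x0 <= sup S by apply: ub_le_sup => //; case: supS.
have lo_le : inf S <= x0 by apply: ge_inf => //; case: infS.
have hi1 : sup S <= 1 by apply: ge_sup => // x [/andP[]].
have lo0 : 0 <= inf S by apply: lb_le_inf => // x [/andP[]].
have Fhi : F (sup S) <= 0.
  apply: close; first by case/andP: x01 => x00 _; rewrite hi1 (le_trans x00).
  move=> e e0; have [x Sx xs] := sup_adherent e0 supS; exists x => //.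
  rewrite ger0_norm ?subr_ge0; last by apply: ub_le_sup => //; case: supS.
  by rewrite lerBlDr -lerBlDl ltW.
have Flo : F (inf S) <= 0.
  apply: close; first by case/andP: x01 => _ x1; rewrite lo0 (le_trans lo_le).
  move=> e e0; have [x Sx xs] := inf_adherent e0 infS; exists x => //.
  rewrite distrC ger0_norm ?subr_ge0; last by apply: ge_inf => //; case: infS.
  by rewrite lerBlDl ltW.
exists (inf S), (sup S); split=> //; first exact: le_trans hi_ge.
move=> x x01'; apply/idP/idP => [Fx|xin]; last exact: Fq xin Flo Fhi.
apply/andP; split; first by apply: ge_inf => //; case: infS.
by apply: ub_le_sup => //; case: supS.
Qed.

Variables (M : nat) (A B : 'I_M -> R) (V : R -> R) (K : R).
Let line m x := x * A m + (1 - x) * B m.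
Hypothesis V_lip : forall x y : R, 0 <= x <= 1 -> 0 <= y <= 1 ->
  V x <= V y + K * `|x - y|.
Hypothesis V_concave : forall x y t : R, 0 <= x <= 1 -> 0 <= y <= 1 -> 0 <= t <= 1 ->
  t * V x + (1 - t) * V y <= V (t * x + (1 - t) * y).
Hypothesis V_line : forall m (x : R), 0 <= x <= 1 -> V x <= line m x.

Let optimal_interval m : (exists2 x : R, 0 <= x <= 1 & line m x <= V x) ->
  exists lo hi : R, [/\ 0 <= lo, lo <= hi, hi <= 1 &
    forall x : R, 0 <= x <= 1 -> (line m x <= V x) = (lo <= x <= hi)].
Proof.
move=> [x0 x01 act].
pose F x := line m x - V x.
have [] := @sublevel_interval F (K + `|A m - B m|).
- move=> x y xin yin.
  have lineE : line m x = line m y + (x - y) * (A m - B m).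
    by rewrite /line; ring.
  have lip : V y <= V x + K * `|x - y| by rewrite distrC V_lip.
  have : (x - y) * (A m - B m) <= `|A m - B m| * `|x - y|.
    by rewrite mulrC -normrM ler_norm.
  rewrite /F lineE mulrDl; lra.
- move=> x y z x0' y1 /andP[xz zy]; rewrite /F !subr_le0 => Fx Fy.
  have [xy|xy] := ltP x y; last first.
    by have -> : z = x by apply/eqP; rewrite eq_le (le_trans zy xy).
  pose t := (y - z) / (y - x).
  have yx0 : 0 < y - x by rewrite subr_gt0.
  have t01 : 0 <= t <= 1.
    by rewrite /t divr_ge0 ?subr_ge0 ?(ltW xy) //= ler_pdivrMr // mul1r; lra.
  have zE : z = t * x + (1 - t) * y.
    rewrite /t; field; exact: lt0r_neq0.
  have lineE : line m z = t * line m x + (1 - t) * line m y.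
    by rewrite [in LHS]zE /line; ring.
  rewrite lineE {1}zE; apply: le_trans (V_concave _ _ t01); try lra.
  by case/andP: t01 => t0 t1; rewrite lerD // ler_wpM2l // subr_ge0.
- by exists x0 => //; rewrite /F subr_le0.
move=> lo [hi [lo0 lohi hi1 FE]]; exists lo, hi; split=> // x x01'.
by rewrite -FE // /F subr_le0.
Qed.

(** Messages are listed by decreasing slope of their cost line, which is the
    order of their optimality intervals from left to right.  Only messages
    that are optimal somewhere are listed; the last one is repeated, with a
    degenerate interval, until there are M of them.  The map [s] is therefore
    in general neither injective nor surjective. *)
Lemma optimal_chain (M_gt0 : (0 < M)%N) :
  (exists m, exists2 x : R, 0 <= x <= 1 & line m x <= V x) ->
  exists (s : 'I_M -> 'I_M) (alpha beta : nat -> R),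
   [/\ chained (M := M) alpha beta,
    forall (j : 'I_M) x, alpha j <= x <= beta j -> line (s j) x <= V x
   & forall m (x : R), 0 <= x <= 1 -> line m x <= V x ->
      exists j : 'I_M, alpha j <= x <= beta j].
Proof.
move=> [m0 act0].
pose active m := `[< exists2 x : R, 0 <= x <= 1 & line m x <= V x >].
pose steeper m m' := A m' - B m' <= A m - B m.
pose e0 := sort steeper [seq m <- enum 'I_M | active m].
have mem_e0 m : (m \in e0) = active m.
  by rewrite mem_sort mem_filter mem_enum andbT.
have sz0 : (0 < size e0)%N.
  have : (index m0 e0 < size e0)%N by rewrite index_mem mem_e0; exact/asboolP.
  exact: leq_ltn_trans.
have szM : (size e0 <= M)%N.
  by rewrite size_sort size_filter (leq_trans (count_size _ _)) // size_enum_ord.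
have srt : sorted steeper e0 by apply: sort_sorted => x y; exact: le_total.
pose e i := nth m0 e0 (minn i (size e0).-1).
have e_act i : active (e i).
  by rewrite -mem_e0 mem_nth // (leq_ltn_trans (geq_minr _ _)) // ltn_predL.
have e_slope i : A (e i.+1) - B (e i.+1) <= A (e i) - B (e i).
  have [lti|gei] := ltnP i.+1 (size e0); last first.
    have le1 : ((size e0).-1 <= i)%N by rewrite -ltnS prednK.
    by rewrite /e (minn_idPr le1) (minn_idPr (leqW le1)).
  have le1 : (i.+1 <= (size e0).-1)%N by rewrite -ltnS prednK.
  rewrite /e (minn_idPl le1) (minn_idPl (ltnW le1)).
  exact: (sortedP m0 srt).
have /choice[lo /choice[hi lohi]] m : exists l h : R, active m ->
    [/\ 0 <= l, l <= h, h <= 1 &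
     forall x : R, 0 <= x <= 1 -> (line m x <= V x) = (l <= x <= h)].
  have [/asboolP/optimal_interval[l [h lh]]|//] := boolP (active m).
    by exists l, h.
  by exists 0, 0.
(* Intervals of distinct slopes lie side by side; equal slopes mean equal
   lines, hence equal intervals. *)
have step i : (hi (e i) <= lo (e i.+1)) \/
    (lo (e i) = lo (e i.+1) /\ hi (e i) = hi (e i.+1)).
  have [l0 lh h1 E] := lohi _ (e_act i).
  have [l0' lh' h1' E'] := lohi _ (e_act i.+1).
  set m := e i in l0 lh h1 E *; set m' := e i.+1 in l0' lh' h1' E' *.
  have lineB x y : line m x - line m' x = line m y - line m' y +
      (x - y) * ((A m - B m) - (A m' - B m')) by rewrite /line; ring.
  have h01 : 0 <= hi m <= 1 by rewrite h1 (le_trans l0).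
  have l01 : 0 <= lo m <= 1 by rewrite l0 (le_trans lh).
  have l01' : 0 <= lo m' <= 1 by rewrite l0' (le_trans lh').
  have h01' : 0 <= hi m' <= 1 by rewrite h1' (le_trans l0').
  have opt : line m (hi m) <= line m' (hi m).
    by apply: le_trans (V_line _ h01); rewrite E // lexx lh.
  have opt' : line m' (lo m') <= line m (lo m').
    by apply: le_trans (V_line _ l01'); rewrite E' // lexx lh'.
  have := e_slope i; rewrite -/m -/m' le_eqVlt => /predU1P[slE|slL].
    have lineE x : line m x = line m' x.
      move: (lineB x (hi m)) (lineB x (lo m')); rewrite slE subrr !mulr0; lra.
    right; have inE (x : R) : 0 <= x <= 1 -> (lo m <= x <= hi m) = (lo m' <= x <= hi m').
      by move=> x01; rewrite -E // -E' // lineE.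
    move: (inE _ l01) (inE _ h01) (inE _ l01') (inE _ h01').
    rewrite !lexx lh lh' /= => /esym/andP[a1 a2] /esym/andP[a3 a4].
    move=> /andP[a5 a6] /andP[a7 a8].
    by split; apply/le_anti; apply/andP.
  left; rewrite leNgt; apply/negP => ltl.
  have : 0 < (hi m - lo m') * (A m - B m - (A m' - B m')).
    by rewrite mulr_gt0 // subr_gt0.
  move: (lineB (hi m) (lo m')); lra.
(* Starting each interval at the end of the previous one disposes of repeated
   lines: their interval shrinks to its right end-point. *)
pose al i := if i is i'.+1 then Num.max (lo (e i)) (hi (e i')) else lo (e i).
pose be i := hi (e i).
have hi_mono i : be i <= be i.+1.
  have [l0 lh h1 E] := lohi _ (e_act i.+1).
  by rewrite /be; case: (step i) => [h|[_ ->]//]; rewrite (le_trans h).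
have al_be i : al i <= be i.
  have [l0 lh h1 E] := lohi _ (e_act i).
  by case: i l0 lh h1 E => [|i] l0 lh h1 E //=; rewrite ge_max lh; exact: hi_mono.
have be_al i : be i <= al i.+1 by rewrite /= le_max lexx orbT.
have lo_al i : lo (e i) <= al i by case: i => [|i] //=; rewrite le_max lexx.
have be_mono i j : (i <= j)%N -> be i <= be j.
  by elim: j => [|j IH]; rewrite leq_eqVlt => /predU1P[->//|//] /IH /le_trans->.
have be_al' i j : (i < j)%N -> be i <= al j.
  by case: j => [//|j]; rewrite ltnS => /be_mono /le_trans->.
exists (fun j => e (M.-1 - j)%N), (fun j => al (M.-1 - j)%N),
  (fun j => be (M.-1 - j)%N); split.
- split=> [m mM|i j ij jM||]; first exact: al_be.
  + apply: be_al'; apply: ltn_sub2l => //; apply: leq_trans ij _.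
    by rewrite -ltnS prednK.
  + rewrite subnn; have [] := lohi _ (e_act 0%N).
    by move=> l0 _ _ _; exact: le_trans (lo_al 0%N).
  + by have [] := lohi _ (e_act (M.-1 - 0)%N).
- move=> j x; set i := (M.-1 - j)%N => /andP[ax xb].
  have [l0 lh h1 E] := lohi _ (e_act i).
  have x01 : 0 <= x <= 1.
    by rewrite (le_trans _ h1) // andbT (le_trans l0) // (le_trans (lo_al i)).
  by rewrite E // xb andbT (le_trans (lo_al i)).
- move=> m x x01 lx.
  have act : active m by apply/asboolP; exists x.
  have ex : exists i, (i < M)%N && (line (e i) x <= V x).
    exists (index m e0).
    have lti : (index m e0 < size e0)%N by rewrite index_mem mem_e0.
    rewrite (leq_trans lti) //= /e (minn_idPl _) ?nth_index ?mem_e0 //.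
    by rewrite -ltnS prednK.
  (* The leftmost optimal message: its interval has not been cut at [x]. *)
  case: (ex_minnP ex) => i /andP[iM li] imin.
  have jM : (M.-1 - i < M)%N.
    by rewrite (leq_ltn_trans (leq_subr _ _)) // ltn_predL.
  exists (Ordinal jM) => /=.
  have -> : (M.-1 - (M.-1 - i) = i)%N by rewrite subKn // -ltnS prednK.
  have [l0 lh h1 E] := lohi _ (e_act i).
  move: (li); rewrite E // => /andP[lx' ->]; rewrite andbT.
  case: i iM li imin {jM l0 lh h1} E lx' => [//|i] iM li imin E lx' /=.
  rewrite ge_max lx' /=; case: (step i) => [h|[el eh]].
    exact: le_trans lx'.
  have [_ _ _ E0] := lohi _ (e_act i).
  have : (i < M)%N && (line (e i) x <= V x).
    by rewrite ltnW //= E0 // el eh -E.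
  by move=> /imin; rewrite ltnn.
Qed.

End Intervals.

(** * Measures with densities, and uniqueness on rectangles *)

Section Density.
Context {d : measure_display} {T : measurableType d} {R : realType}.
Local Open Scope ereal_scope.
Implicit Types (m rho : {measure set T -> \bar R}).

Definition dens_measure rho (g : T -> R) (mg : measurable_fun setT g)
    (g0 : forall x, (0 <= g x)%R) (A : set T) : \bar R :=
  \int[rho]_(x in A) (g x)%:E.

Section DensMeasure.
Variables (rho : {measure set T -> \bar R}) (g : T -> R).
Variables (mg : measurable_fun setT g) (g0 : forall x, (0 <= g x)%R).
Local Notation nu := (dens_measure rho mg g0).

Let nu0 : nu set0 = 0. Proof. exact: integral_set0. Qed.

Let nu_ge0 A : 0 <= nu A.
Proof. by apply: integral_ge0 => x _; rewrite lee_fin. Qed.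

Let nu_additive : semi_sigma_additive nu.
Proof.
apply: semi_sigma_additive_nng_induced => [|x]; last by rewrite lee_fin.
exact/measurable_EFinP.
Qed.

HB.instance Definition _ := isMeasure.Build _ _ _ nu nu0 nu_ge0 nu_additive.

End DensMeasure.

Import HBNNSimple.

(** Both sides are limits along the same simple functions, for which the equality
    is the hypothesis on sets. *)
Lemma ge0_integral_density m rho (g : T -> R) (f : T -> \bar R) :
  measurable_fun setT g -> (forall x, (0 <= g x)%R) ->
  (forall A, measurable A -> m A = \int[rho]_(x in A) (g x)%:E) ->
  measurable_fun setT f -> (forall x, 0 <= f x) ->
  \int[m]_x f x = \int[rho]_x (f x * (g x)%:E).
Proof.
move=> mg g0 mE mf f0.
have mgE : measurable_fun setT (EFin \o g) by exact/measurable_EFinP.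
pose h := nnsfun_approx measurableT mf.
have mh n : measurable_fun setT (EFin \o h n) by exact/measurable_EFinP.
have h0 n x : 0 <= (EFin \o h n) x by rewrite /= lee_fin.
have hle x a b : (a <= b)%N -> (EFin \o h a) x <= (EFin \o h b) x.
  by move=> ab; rewrite lee_fin; exact/lefP/nd_nnsfun_approx.
have -> : \int[m]_x f x = limn (fun n => \int[m]_x (EFin \o h n) x).
  rewrite -monotone_convergence//; last by move=> x _ a b; exact: hle.
  apply: eq_integral => x _; apply/esym/cvg_lim => //.
  exact: cvg_nnsfun_approx.
have -> : \int[rho]_x (f x * (g x)%:E) =
    limn (fun n => \int[rho]_x ((EFin \o h n) x * (g x)%:E)).
  rewrite -monotone_convergence//; first last.
  - by move=> x _ a b ab; rewrite lee_wpmul2r ?lee_fin//; exact: hle.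
  - by move=> n x _; rewrite mule_ge0 ?lee_fin.
  - by move=> n; exact: emeasurable_funM.
  apply: eq_integral => x _; apply/esym/cvg_lim => //.
  by apply: cvgeZr => //; exact: cvg_nnsfun_approx.
congr (limn _); apply/funext => n.
rewrite integralT_nnsfun sintegralE.
under eq_integral => x _.
  rewrite /= (fimfunE (h n) x) -fsumEFin//.
  rewrite ge0_mule_fsuml; last by move=> y; exact: nnfun_muleindic_ge0.
  over.
rewrite ge0_integral_fsum//; last 2 first.
- move=> y; apply: emeasurable_funM => //; apply/measurable_EFinP.
  exact: measurable_funM.
- by move=> y x _; rewrite mule_ge0 ?lee_fin// -lee_fin nnfun_muleindic_ge0.
apply: eq_fsbigr => r /[!inE] -[t _ <-{r}].
have mA : measurable (h n @^-1` [set h n t]) by exact: measurable_sfunP.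
rewrite mE// integral_mkcond -ge0_integralZl ?lee_fin//; last 2 first.
- by apply/measurable_restrict => //; exact: measurable_funTS.
- by move=> x _; apply: erestrict_ge0 => y _; rewrite lee_fin.
apply: eq_integral => x _; rewrite epatch_indic /= EFinM -muleA; congr (_ * _).
by rewrite muleC.
Qed.

End Density.

Section Uniqueness.
Context {R : realType}.
Local Open Scope ereal_scope.

Lemma rectangle_unique d1 d2 (T1 : measurableType d1) (T2 : measurableType d2)
    (m1 m2 : {measure set (T1 * T2) -> \bar R}) :
  m1 setT < +oo ->
  (forall A B, measurable A -> measurable B -> m1 (A `*` B) = m2 (A `*` B)) ->
  forall X, measurable X -> m1 X = m2 X.
Proof.
move=> m1oo m12; apply: (measure_unique
  [set A `*` B | A in measurable & B in measurable] (fun=> setT)) => //.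
- exact: measurable_prod_measurableType.
- move=> _ _ [A mA [B mB <-]] [A' mA' [B' mB' <-]]; rewrite -setXI.
  by exists (A `&` A'); [exact: measurableI|exists (B `&` B') => //; exact: measurableI].
- by move=> _; exists setT => //; exists setT => //; rewrite setXTT.
- by rewrite bigcup_const//; exists 0%N.
- by move=> _ [A mA [B mB <-]]; exact: m12.
Qed.

Definition box n d (T : measurableType d) (A : 'I_n -> set T) : set (n.-tuple T) :=
  [set y | forall i, A i (tnth y i)].

Lemma measurable_box n d (T : measurableType d) (A : 'I_n -> set T) :
  (forall i, measurable (A i)) -> measurable (box A).
Proof.
move=> mA; have -> : box A = \bigcap_(i in setT) ((@tnth _ T ^~ i) @^-1` A i).
  by apply/seteqP; split=> [y Ay i _|y Ay i]; exact: Ay.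
apply: fin_bigcap_measurable => // i _.
by rewrite -[X in measurable X]setTI; apply: measurable_tnth.
Qed.

(** Boxes are stable under intersection and generate the sigma-algebra of
    tuples. *)
Lemma box_unique n d (T : measurableType d)
    (m1 m2 : {measure set (n.-tuple T) -> \bar R}) :
  m1 setT < +oo ->
  (forall A : 'I_n -> set T, (forall i, measurable (A i)) ->
     m1 (box A) = m2 (box A)) ->
  forall X, measurable X -> m1 X = m2 X.
Proof.
move=> m1oo m12.
have boxT : @box n _ T (fun=> setT) = setT by apply/seteqP; split.
apply: (measure_unique
  [set box A | A in [set A | forall i, measurable (A i)]] (fun=> setT)) => //.
- rewrite eqEsubset; split; last first.
    apply: smallest_sub; first exact: sigma_algebra_measurable.
    by move=> _ [A mA <-]; exact: measurable_box.
  rewrite {1}/measurable /= /g_sigma_preimage.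
  apply: smallest_sub; first exact: smallest_sigma_algebra.
  move=> X; rewrite -bigcup_seq => -[i /= _ [B mB <-]].
  apply: sub_sigma_algebra; exists (fun j => if j == i then B else setT).
    by move=> j /=; case: ifP.
  rewrite setTI; apply/seteqP; split=> y /=; last by move=> By j; case: eqP => [->|].
  by move=> /(_ i); rewrite eqxx.
- move=> _ _ [A mA <-] [B mB <-]; exists (fun i => A i `&` B i).
    by move=> i; exact: measurableI.
  apply/seteqP; split=> [y yAB|y [Ay By] i]; last by split; [exact: Ay|exact: By].
  by split=> i; case: (yAB i).
- by move=> _; exists (fun=> setT).
- by rewrite bigcup_const//; exists 0%N.
- by move=> _ [A mA <-]; exact: m12.
Qed.

End Uniqueness.

Section SubLaw.
Context {R : realType} {dW d : measure_display}.
Context {Omega : measurableType dW} {T : measurableType d}.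
Local Open Scope ereal_scope.

(** The law of [X] on the event [E], not normalised. *)
Definition sub_law (P : probability Omega R) (E : set Omega)
    (mE : measurable E) (X : {mfun Omega >-> T}) (A : set T) : \bar R :=
  P (E `&` X @^-1` A).

Variables (P : probability Omega R) (E : set Omega) (mE : measurable E).
Variable X : {mfun Omega >-> T}.
Local Notation nu := (sub_law P mE X).

Let mX A : measurable A -> measurable (E `&` X @^-1` A).
Proof. by move=> mA; apply: measurableI => //; exact: measurable_funPTI. Qed.

Let nu0 : nu set0 = 0.
Proof. by rewrite /sub_law preimage_set0 setI0 measure0. Qed.

Let nu_ge0 A : 0 <= nu A. Proof. exact: measure_ge0. Qed.

Let nu_additive : semi_sigma_additive nu.
Proof.
move=> F mF tF mUF; rewrite /sub_law preimage_bigcup setI_bigcupr.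
apply: measure_semi_sigma_additive.
- by move=> n; exact: mX.
- apply/trivIsetP => i j _ _ ij; rewrite setIACA.
  have FF : F i `&` F j = set0 by move/trivIsetP : tF => /(_ i j I I ij).
  by rewrite -(preimage_setI X) FF preimage_set0 setI0.
- by rewrite -setI_bigcupr -preimage_bigcup; exact: mX.
Qed.

HB.instance Definition _ := isMeasure.Build _ _ _ nu nu0 nu_ge0 nu_additive.

Lemma sub_law_lty A : measurable A -> sub_law P mE X A < +oo.
Proof.
by move=> mA; rewrite (le_lt_trans (probability_le1 P (mX mA)))// ltry.
Qed.

End SubLaw.

(** * Bayes' rule for one more observation *)

Section Belief.
Context {R : realType} {dW d : measure_display}.
Context {Omega : measurableType dW} {T : measurableType d}.
Variables (P : probability Omega R) (H : {RV P >-> bool}).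
Local Open Scope ereal_scope.

Definition hyp (h : bool) : set Omega := [set w | H w = h].

Lemma measurable_hyp h : measurable (hyp h).
Proof. by rewrite -[hyp h]/(H @^-1` [set h]); apply: measurable_funPTI. Qed.

Lemma hyp_split (A : set Omega) : measurable A ->
  P A = P (hyp false `&` A) + P (hyp true `&` A).
Proof.
move=> mA; rewrite -measureU.
- congr (P _); apply/seteqP; split=> w; last by case=> -[].
  by move=> Aw; case E: (H w); [right|left].
- by apply: measurableI => //; exact: measurable_hyp.
- by apply: measurableI => //; exact: measurable_hyp.
- by apply/seteqP; split=> // w [[Hf _] [Ht _]]; have := etrans (esym Hf) Ht.
Qed.

(** The belief that H = h when [x] is the belief that H = 0. *)
Definition wt (h : bool) (x : R) : R := (if h then 1 - x else x)%R.

Lemma wt_ge0 h x : (0 <= x <= 1)%R -> (0 <= wt h x)%R.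
Proof. by move=> /andP[x0 x1]; case: h; rewrite //= subr_ge0. Qed.

Lemma measurable_wt h (p : T -> R) :
  measurable_fun setT p -> measurable_fun setT (fun z => wt h (p z)).
Proof. by move=> mp; case: h => //=; exact: measurable_funB. Qed.

Variables (X : {mfun Omega >-> T}) (p : T -> R).
Hypothesis mp : measurable_fun setT p.
Hypothesis p01 : forall z, (0 <= p z <= 1)%R.
Hypothesis pE : forall A, measurable A ->
  P (hyp false `&` X @^-1` A) = \int[P]_(w in X @^-1` A) (p (X w))%:E.

(** The case of H = 1 follows by complement, all quantities being finite. *)
Lemma belief_wt h A : measurable A ->
  P (hyp h `&` X @^-1` A) = \int[P]_(w in X @^-1` A) (wt h (p (X w)))%:E.
Proof.
move=> mA; case: h => /=; last exact: pE.
have mXA : measurable (X @^-1` A) by exact: measurable_funPTI.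
have fin h : P (hyp h `&` X @^-1` A) \is a fin_num.
  by apply: fin_num_measure; apply: measurableI => //; exact: measurable_hyp.
have mpX h : measurable_fun (X @^-1` A) (fun w => (wt h (p (X w)))%:E).
  apply: measurable_funTS; apply/measurable_EFinP.
  exact: measurableT_comp (measurable_wt h mp) _.
rewrite -[LHS](addeK _ (fin false)) -[RHS](addeK _ (fin false)); congr (_ - _).
rewrite addeC -hyp_split// addeC pE// -ge0_integralD//.
- rewrite (eq_integral (cst 1)) ?integral_cst ?mul1e//.
  by move=> w _; rewrite -EFinD addrC subrK.
- by move=> w _; rewrite lee_fin; case/andP: (p01 (X w)).
- exact: (mpX false).
- by move=> w _; rewrite lee_fin; exact: (wt_ge0 true (p01 (X w))).
- exact: (mpX true).
Qed.

Lemma belief_wt_distribution h A : measurable A ->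
  P (hyp h `&` X @^-1` A) = \int[distribution P X]_(z in A) (wt h (p z))%:E.
Proof.
move=> mA; rewrite ge0_integral_pushforward ?belief_wt//.
- by apply: measurable_funTS; apply/measurable_EFinP; exact: measurable_wt.
- by move=> z _; rewrite lee_fin; exact: wt_ge0.
Qed.

End Belief.

Section PairMfun.
Context {dW d1 d2 : measure_display} {Omega : measurableType dW}.
Context {T1 : measurableType d1} {T2 : measurableType d2}.
Variables (X : {mfun Omega >-> T1}) (Y : {mfun Omega >-> T2}).

Definition pair_mfun (w : Omega) : T1 * T2 := (X w, Y w).

Let measurable_pair_mfun : measurable_fun setT pair_mfun.
Proof. exact: measurable_fun_pair. Qed.

HB.instance Definition _ :=
  isMeasurableFun.Build _ _ _ _ pair_mfun measurable_pair_mfun.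

End PairMfun.

Section BayesStep.
Context {R : realType} {dW d1 d2 : measure_display}.
Context {Omega : measurableType dW}.
Context {T1 : measurableType d1} {T2 : measurableType d2}.
Variables (P : probability Omega R) (H : {RV P >-> bool}).
Variables (X : {mfun Omega >-> T1}) (Y : {mfun Omega >-> T2}).
Variables (mu : {sigma_finite_measure set T2 -> \bar R}) (f : bool -> T2 -> R).
Hypothesis mf : forall h, measurable_fun setT (f h).
Hypothesis f0 : forall h y, 0 <= f h y.
Variables (p : T1 -> R) (r : T1 * T2 -> R).
Hypothesis mp : measurable_fun setT p.
Hypothesis p01 : forall z, 0 <= p z <= 1.
Hypothesis mr : measurable_fun setT r.
Hypothesis r01 : forall z, 0 <= r z <= 1.
Local Open Scope ereal_scope.
Hypothesis pE : forall A, measurable A ->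
  P (hyp H false `&` X @^-1` A) = \int[P]_(w in X @^-1` A) (p (X w))%:E.
Let XY : {mfun Omega >-> (T1 * T2)%type} := pair_mfun X Y.
Hypothesis rE : forall A, measurable A ->
  P (hyp H false `&` XY @^-1` A) = \int[P]_(w in XY @^-1` A) (r (XY w))%:E.
Hypothesis XY_indep : forall h A B, measurable A -> measurable B ->
  P (hyp H h `&` (X @^-1` A `&` Y @^-1` B)) =
  P (hyp H h `&` X @^-1` A) * \int[mu]_(y in B) (f h y)%:E.

Let nu := distribution P X.
Let rho := (nu \x mu).
Let q h (z : T1 * T2) : R := (wt h (p z.1) * f h z.2)%R.

Let q0 h z : (0 <= q h z)%R.
Proof. by rewrite mulr_ge0// wt_ge0. Qed.

Let mq h : measurable_fun setT (q h).
Proof.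
apply: measurable_funM.
  exact: measurableT_comp (measurable_wt h mp) measurable_fst.
exact: measurableT_comp (mf h) measurable_snd.
Qed.

(** By independence given H, it is enough to compare both sides on rectangles. *)
Let joint_density h A : measurable A ->
  P (hyp H h `&` XY @^-1` A) = \int[rho]_(z in A) (q h z)%:E.
Proof.
apply: (rectangle_unique (m1 := sub_law P (measurable_hyp H h) XY)
  (m2 := dens_measure rho (mq h) (q0 h))) => [|B C mB mC].
  exact: sub_law_lty.
change (P (hyp H h `&` (X @^-1` B `&` Y @^-1` C)) =
  \int[rho]_(z in B `*` C) (q h z)%:E).
rewrite XY_indep// (belief_wt_distribution mp p01 pE)//.
rewrite [RHS]integral_mkcond fubini_tonelli1; last 2 first.
- apply/(measurable_restrictT _ _).1 => //; first exact: measurableX.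
  by apply: measurable_funTS; apply/measurable_EFinP; exact: mq.
- by move=> z; apply: erestrict_ge0 => *; rewrite lee_fin.
have mwt : measurable_fun setT (((EFin \o (fun z => wt h (p z))) \_ B)).
  apply/(measurable_restrictT _ _).1 => //; apply: measurable_funTS.
  by apply/measurable_EFinP; exact: measurable_wt.
have mfC : measurable_fun setT ((EFin \o f h) \_ C).
  apply/(measurable_restrictT _ _).1 => //; apply: measurable_funTS.
  exact/measurable_EFinP.
have f0C y : 0 <= ((EFin \o f h) \_ C) y.
  by apply: erestrict_ge0 => *; rewrite lee_fin.
have wt0B z : 0 <= ((EFin \o (fun z => wt h (p z))) \_ B) z.
  by apply: erestrict_ge0 => t _; rewrite lee_fin wt_ge0.
rewrite integral_mkcond [X in _ * X]integral_mkcond -ge0_integralZr//; last first.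
  by apply: integral_ge0 => y _; exact: f0C.
apply: eq_integral => z _; rewrite /fubini_F -ge0_integralZl//.
apply: eq_integral => y _; rewrite !patchE in_setX /=.
by case: (z \in B); case: (y \in C); rewrite /= ?mul0e ?mule0.
Qed.

Let g z := (q false z + q true z)%R.

Let mg : measurable_fun setT g. Proof. exact: measurable_funD. Qed.
Let g0 z : (0 <= g z)%R. Proof. exact: addr_ge0. Qed.

Let XY_density A : measurable A ->
  distribution P XY A = \int[rho]_(z in A) (g z)%:E.
Proof.
move=> mA; rewrite /distribution /pushforward (hyp_split H); last first.
  exact: measurable_funPTI.
rewrite !joint_density// -ge0_integralD//.
- by move=> z _; rewrite lee_fin.
- by apply: measurable_funTS; apply/measurable_EFinP; exact: mq.
- by move=> z _; rewrite lee_fin.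
- by apply: measurable_funTS; apply/measurable_EFinP; exact: mq.
Qed.

Let int_XY (F : T1 * T2 -> \bar R) : measurable_fun setT F -> (forall z, 0 <= F z) ->
  \int[P]_w F (XY w) = \int[rho]_z (F z * (g z)%:E).
Proof.
move=> mF F0; rewrite -(ge0_integral_density mg g0 XY_density mF F0).
by rewrite ge0_integral_distribution.
Qed.

(** The updated belief is the posterior: both it and Bayes' formula are
    densities of the same measure. *)
Let bayes : ae_eq rho setT (EFin \o q false) (fun z => (r z * g z)%:E).
Proof.
apply: integral_ae_eq => //.
- apply/integrableP; split; first by apply/measurable_EFinP; exact: mq.
  under eq_integral => z _ do rewrite gee0_abs ?lee_fin//.
  rewrite -joint_density//; apply: le_lt_trans (probability_le1 P _) (ltry _).
  by apply: measurableI; [exact: measurable_hyp|exact: measurable_funPTI].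
- by apply/measurable_EFinP; exact: measurable_funM.
- move=> A _ mA; rewrite -joint_density// rE// [LHS]integral_mkcond.
  have mrA : measurable_fun setT ((EFin \o r) \_ A).
    apply/(measurable_restrictT _ _).1 => //; apply: measurable_funTS.
    exact/measurable_EFinP.
  have rA0 z : 0 <= ((EFin \o r) \_ A) z.
    by apply: erestrict_ge0 => t _; rewrite lee_fin; case/andP: (r01 t).
  transitivity (\int[P]_w ((EFin \o r) \_ A) (XY w)).
    by apply: eq_integral => w _; rewrite !patchE.
  rewrite int_XY// [RHS]integral_mkcond; apply: eq_integral => z _.
  by rewrite !patchE; case: ifP; rewrite ?mul0e.
Qed.

Variable W : R -> R -> R.
Hypothesis mW : measurable_fun setT (fun z : R * R => W z.1 z.2).
Hypothesis W0 : forall a b, (0 <= W a b)%R.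
Hypothesis W_homog : forall c a b, (0 <= c)%R -> (0 <= a)%R -> (0 <= b)%R ->
  W (c * a) (c * b) = (c * W a b)%R.

Let mWc d (T : measurableType d) (u v : T -> R) : measurable_fun setT u ->
  measurable_fun setT v -> measurable_fun setT (fun t => (W (u t) (v t))%:E).
Proof.
move=> mu' mv; apply/measurable_EFinP.
exact: (measurableT_comp mW (measurable_fun_pair mu' mv)).
Qed.

(** Under the law of (X, Y) the weights (r, 1 - r) are, by Bayes' formula, the
    two joint densities divided by their sum [g].  Integrating against this law
    multiplies by [g], and by homogeneity of [W] the factor disappears: what is
    left is an integral against the reference measure, in which the belief
    given [X] enters linearly. *)
Lemma bayes_step A : measurable A ->
  \int[P]_(w in X @^-1` A) (W (r (X w, Y w)) (1 - r (X w, Y w)))%:E =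
  \int[P]_(w in X @^-1` A)
    \int[mu]_y (W (p (X w) * f false y) ((1 - p (X w)) * f true y))%:E.
Proof.
move=> mA.
have mA1 : measurable (A `*` [set: T2]) by exact: measurableX.
pose F z := (W (r z) (1 - r z))%:E.
pose G z := (W (q false z) (q true z))%:E.
have mF : measurable_fun setT F by apply: mWc => //; exact: measurable_funB.
have mG : measurable_fun setT G by apply: mWc; exact: mq.
have mres (K : T1 * T2 -> \bar R) : measurable_fun setT K ->
    measurable_fun setT (K \_ (A `*` [set: T2])).
  by move=> mK; apply/(measurable_restrictT _ _).1 => //; exact: measurable_funTS.
have res0 (K : T1 * T2 -> \bar R) : (forall z, 0 <= K z) ->
    forall z, 0 <= (K \_ (A `*` [set: T2])) z.
  by move=> K0 z; exact: erestrict_ge0.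
have F0 z : 0 <= F z by rewrite lee_fin.
have G0 z : 0 <= G z by rewrite lee_fin.
transitivity (\int[P]_w (F \_ (A `*` [set: T2])) (XY w)).
  rewrite integral_mkcond; apply: eq_integral => w _; rewrite !patchE in_setX.
  by rewrite in_setT andbT.
rewrite int_XY//; [|exact: mres|exact: res0].
transitivity (\int[rho]_z (G \_ (A `*` [set: T2])) z).
  apply: ge0_ae_eq_integral => //.
  - by apply: emeasurable_funM; [exact: mres|exact/measurable_EFinP].
  - exact: mres.
  - by move=> z _; rewrite mule_ge0 ?lee_fin//; exact: res0.
  - by move=> z _; exact: res0.
  apply: filterS bayes => z /(_ I) /= -[qr] _.
  rewrite !patchE; case: ifP => _; last by rewrite mul0e.
  rewrite -EFinM; congr (_%:E).
  case/andP: (r01 z) => r0 r1.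
  rewrite mulrC -W_homog// ?subr_ge0// -[X in W X](mulrC (r z)) -qr; congr (W _ _).
  by rewrite mulrBr mulr1 mulrC -qr addrC addKr.
rewrite fubini_tonelli1; [|exact: mres|exact: res0].
rewrite ge0_integral_distribution.
- rewrite [RHS]integral_mkcond; apply: eq_integral => w _.
  rewrite /fubini_F /= patchE; have [wA|wA] := boolP (w \in X @^-1` A).
    apply: eq_integral => y _; rewrite patchE in_setX in_setT andbT.
    by rewrite -[X w \in A]/(w \in X @^-1` A) wA.
  rewrite integral0_eq// => y _; rewrite patchE in_setX in_setT andbT.
  by rewrite -[X w \in A]/(w \in X @^-1` A) (negbTE wA).
- by apply: measurable_fun_fubini_tonelli_F; [exact: mres|exact: res0].
- by move=> z; apply: integral_ge0 => y _; exact: res0.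
Qed.

End BayesStep.

(** * Value functions of the stopping problem *)

Section ValueClass.
Context {R : realType}.
Implicit Types (W : R -> R -> R) (K a b : R).

(** [W a b] stands for the optimal cost when the two hypotheses have unnormalised
    weights [a] and [b].  For a homogeneous function superadditivity is
    concavity. *)
Definition regular K W : Prop :=
  [/\ measurable_fun setT (fun z : R * R => W z.1 z.2),
      forall a b, 0 <= W a b,
      forall c a b, 0 <= c -> 0 <= a -> 0 <= b -> W (c * a) (c * b) = c * W a b,
      forall a b a' b', 0 <= a -> 0 <= b -> 0 <= a' -> 0 <= b' ->
        W a b + W a' b' <= W (a + a') (b + b')
    & forall a b a' b', 0 <= a -> 0 <= b -> 0 <= a' -> 0 <= b' ->
        W a b <= W a' b' + K * (`|a - a'| + `|b - b'|)].

(** Clipping keeps the function nonnegative on the whole plane; the relevant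
    weights are nonnegative. *)
Definition lin (A B : R) a b : R := Num.max a 0 * A + Num.max b 0 * B.

Lemma linE (A B : R) a b : 0 <= a -> 0 <= b -> lin A B a b = a * A + b * B.
Proof. by move=> a0 b0; rewrite /lin !max_l. Qed.

Lemma regular_lin K A B : 0 <= A <= K -> 0 <= B <= K -> regular K (lin A B).
Proof.
move=> /andP[A0 AK] /andP[B0 BK]; split.
- by apply: measurable_funD; apply: measurable_funM => //; apply: measurable_maxr.
- by move=> a b; rewrite addr_ge0// mulr_ge0// le_max lexx orbT.
- by move=> c a b c0 a0 b0; rewrite !linE ?mulr_ge0//; ring.
- move=> a b a' b' a0 b0 a0' b0'; rewrite !linE ?addr_ge0//; lra.
- move=> a b a' b' a0 b0 a0' b0'; rewrite !linE//.
  have lip x y D : 0 <= D <= K -> x * D <= y * D + K * `|x - y|.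
    move=> /andP[D0 DK]; have : (x - y) * D <= `|x - y| * D.
      by rewrite ler_wpM2r// ler_norm.
    have : `|x - y| * D <= `|x - y| * K by rewrite ler_wpM2l.
    lra.
  have := lip a a' A; have := lip b b' B; rewrite A0 AK B0 BK => /(_ isT) ? /(_ isT) ?.
  lra.
Qed.

Lemma regular_min K W W' : regular K W -> regular K W' ->
  regular K (fun a b => Num.min (W a b) (W' a b)).
Proof.
move=> [mW W0 Wh Ws Wl] [mW' W0' Wh' Ws' Wl']; split.
- exact: measurable_minr.
- by move=> a b; rewrite le_min W0 W0'.
- by move=> c a b c0 a0 b0; rewrite Wh// Wh'// minr_pMr.
- move=> a b a' b' a0 b0 a0' b0'; rewrite le_min; apply/andP; split.
    by apply: le_trans (Ws _ _ _ _ a0 b0 a0' b0'); rewrite lerD// ge_min lexx.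
  by apply: le_trans (Ws' _ _ _ _ a0 b0 a0' b0'); rewrite lerD// ge_min lexx orbT.
- move=> a b a' b' a0 b0 a0' b0'; rewrite -lerBlDr le_min; apply/andP; split.
    by rewrite lerBlDr (le_trans _ (Wl _ _ _ _ a0 b0 a0' b0'))// ge_min lexx.
  by rewrite lerBlDr (le_trans _ (Wl' _ _ _ _ a0 b0 a0' b0'))// ge_min lexx orbT.
Qed.

Section Transition.
Context {d : measure_display} {T : measurableType d}.
Variables (mu : {sigma_finite_measure set T -> \bar R}) (f : bool -> T -> R).
Hypothesis dens : forall h, is_density mu (f h).

(** Observing [y] multiplies the weights of the hypotheses by their densities at
    [y]. *)
Definition trans W a b : R :=
  fine (\int[mu]_y (W (a * f false y) (b * f true y))%:E).

Variables (K : R) (W : R -> R -> R).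
Hypothesis regW : regular K W.
Let mf h : measurable_fun setT (f h). Proof. by case: (dens h). Qed.
Let f0 h y : 0 <= f h y. Proof. by case: (dens h). Qed.
Let f1 h : (\int[mu]_y (f h y)%:E = 1)%E. Proof. by case: (dens h). Qed.
Let mW : measurable_fun setT (fun z : R * R => W z.1 z.2).
Proof. by case: regW. Qed.
Let W0 a b : 0 <= W a b. Proof. by case: regW. Qed.

Let mWf a b : measurable_fun setT (fun y => (W (a * f false y) (b * f true y))%:E).
Proof.
apply/measurable_EFinP.
apply: (measurableT_comp mW (measurable_fun_pair _ _)); exact: measurable_funM.
Qed.

Let mlin (a b : R) : measurable_fun setT (fun y => (a * f false y + b * f true y)%:E).
Proof.
by apply/measurable_EFinP; apply: measurable_funD; exact: measurable_funM.
Qed.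

Let integral_lin a b : 0 <= a -> 0 <= b ->
  (\int[mu]_y (a * f false y + b * f true y)%:E = (a + b)%:E)%E.
Proof.
move=> a0 b0; under eq_integral do rewrite EFinD.
have mcf c h : measurable_fun setT (fun y => (c * f h y)%:E).
  by apply/measurable_EFinP; exact: measurable_funM.
rewrite ge0_integralD//; first last.
- by move=> y _; rewrite lee_fin mulr_ge0.
- by move=> y _; rewrite lee_fin mulr_ge0.
have cf c h : 0 <= c -> (\int[mu]_y (c * f h y)%:E = c%:E)%E.
  move=> c0; under eq_integral do rewrite EFinM.
  rewrite ge0_integralZl_EFin//; first by rewrite f1 mule1.
    by move=> y _; rewrite lee_fin.
  exact/measurable_EFinP.
by rewrite !cf.
Qed.

Let W_le a b : 0 <= a -> 0 <= b -> W a b <= K * a + K * b.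
Proof.
case: regW => _ _ Wh _ Wl a0 b0.
have W00 : W 0 0 = 0 by have := Wh 0 0 0 (lexx _) (lexx _) (lexx _); rewrite !mul0r.
have := Wl a b 0 0 a0 b0 (lexx _) (lexx _).
by rewrite W00 !subr0 !ger0_norm// add0r mulrDr.
Qed.

Hypothesis K0 : 0 <= K.

Lemma transE a b : 0 <= a -> 0 <= b ->
  (\int[mu]_y (W (a * f false y) (b * f true y))%:E = (trans W a b)%:E)%E.
Proof.
move=> a0 b0; rewrite /trans fineK// ge0_fin_numE; last first.
  by apply: integral_ge0 => y _; rewrite lee_fin.
apply: (@le_lt_trans _ _ (\int[mu]_y ((K * a) * f false y + (K * b) * f true y)%:E)%E).
  apply: ge0_le_integral => //.
  - by move=> y _; rewrite lee_fin.
  - by move=> y _; rewrite lee_fin -!mulrA W_le// mulr_ge0.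
by rewrite integral_lin ?mulr_ge0// ltry.
Qed.

Lemma trans_false : trans W 0 1 = W 0 1.
Proof.
apply: EFin_inj; rewrite -transE//; case: regW => _ _ Wh _ _.
under eq_integral => y _.
  rewrite mul0r mul1r -[X in W X _](mulr0 (f true y)) -[X in W _ X]mulr1.
  rewrite Wh// mulrC EFinM; over.
rewrite ge0_integralZl_EFin//; first by rewrite f1 mule1.
  by move=> y _; rewrite lee_fin.
exact/measurable_EFinP.
Qed.

(** Concavity of the continuation cost: an integral of concave homogeneous
    functions of the pair of weights is again concave and homogeneous, and the
    Lipschitz constant does not grow because each density integrates to 1. *)
Lemma regular_trans : regular K (trans W).
Proof.
case: (regW) => _ _ Wh Ws Wl; split.
- apply: (@measurableT_comp _ _ _ _ _ _ fine _
    (fun z : R * R => \int[mu]_y (W (z.1 * f false y) (z.2 * f true y))%:E)%E).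
    exact: fine_measurable.
  apply: (measurable_fun_fubini_tonelli_F
    (fun u : (R * R) * T => (W (u.1.1 * f false u.2) (u.1.2 * f true u.2))%:E)).
    apply/measurable_EFinP.
    apply: (measurableT_comp mW (measurable_fun_pair _ _)).
      apply: measurable_funM; last exact: measurableT_comp.
      exact: (measurableT_comp measurable_fst measurable_fst).
    apply: measurable_funM; last exact: measurableT_comp.
    exact: (measurableT_comp measurable_snd measurable_fst).
  by move=> u; rewrite lee_fin.
- by move=> a b; rewrite fine_ge0// integral_ge0// => y _; rewrite lee_fin.
- move=> c a b c0 a0 b0; apply: EFin_inj; rewrite -transE ?mulr_ge0//.
  rewrite EFinM -transE// -ge0_integralZl_EFin//.
    by apply: eq_integral => y _; rewrite -!mulrA Wh ?mulr_ge0// EFinM.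
  by move=> y _; rewrite lee_fin.
- move=> a b a' b' a0 b0 a0' b0'; rewrite -lee_fin EFinD -!transE ?addr_ge0//.
  rewrite -ge0_integralD//; first last.
  - by move=> y _; rewrite lee_fin.
  - by move=> y _; rewrite lee_fin.
  apply: ge0_le_integral => //.
  - by move=> y _; rewrite lee_fin addr_ge0.
  - exact: emeasurable_funD.
  - by move=> y _; rewrite -EFinD lee_fin !mulrDl Ws// mulr_ge0.
- move=> a b a' b' a0 b0 a0' b0'; rewrite -lee_fin EFinD -!transE//.
  have KM x : 0 <= K * `|x| by rewrite mulr_ge0.
  rewrite mulrDr -integral_lin// -ge0_integralD//; first last.
  - by move=> y _; rewrite lee_fin addr_ge0// mulr_ge0.
  - by move=> y _; rewrite lee_fin.
  apply: ge0_le_integral => //.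
  - by move=> y _; rewrite lee_fin.
  - exact: emeasurable_funD.
  - move=> y _; rewrite -EFinD lee_fin.
    apply: le_trans (Wl _ _ (a' * f false y) (b' * f true y) _ _ _ _) _;
      rewrite ?mulr_ge0//.
    by rewrite -!mulrBl !normrM !(ger0_norm (f0 _ _)) mulrDr !mulrA.
Qed.

End Transition.

Lemma regular_lip K W (x y : R) : regular K W -> 0 <= x <= 1 -> 0 <= y <= 1 ->
  W x (1 - x) <= W y (1 - y) + (K + K) * `|x - y|.
Proof.
move=> [_ _ _ _ Wl] /andP[x0 x1] /andP[y0 y1].
have := Wl x (1 - x) y (1 - y) x0; rewrite !subr_ge0 => /(_ x1 y0 y1).
have -> : 1 - x - (1 - y) = - (x - y) by ring.
by rewrite normrN mulrDr mulrDl.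
Qed.

Lemma regular_concave K W (x y t : R) : regular K W ->
  0 <= x <= 1 -> 0 <= y <= 1 -> 0 <= t <= 1 ->
  t * W x (1 - x) + (1 - t) * W y (1 - y) <=
    W (t * x + (1 - t) * y) (1 - (t * x + (1 - t) * y)).
Proof.
move=> [_ _ Wh Ws _] /andP[x0 x1] /andP[y0 y1] /andP[t0 t1].
rewrite -!Wh ?subr_ge0//.
have -> : 1 - (t * x + (1 - t) * y) = t * (1 - x) + (1 - t) * (1 - y) by ring.
by apply: Ws; rewrite mulr_ge0 ?subr_ge0.
Qed.

End ValueClass.

Section Values.
Context {R : realType} {d : measure_display} {T : measurableType d}.
Variables (mu : nat -> {sigma_finite_measure set T -> \bar R}).
Variables (f : nat -> bool -> T -> R).
Hypothesis dens : forall t h, (1 <= t)%N -> is_density (mu t) (f t h).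
Variables (M T1 : nat) (cost : nat -> 'I_M -> bool -> R) (K : R).
Hypothesis cost_bnd : forall k m h, 0 <= cost k m h <= K.
Hypothesis M_gt0 : (0 < M)%N.

Definition stop_or_continue k (C : R -> R -> R) a b : R :=
  \big[Num.min/C a b]_(m < M) lin (cost k m false) (cost k m true) a b.

(** [n] is the number of stages left.  At the last stage O1 cannot go on; there
    the bound [K] on all costs serves as the cost of continuing, so that it never
    beats a message. *)
Fixpoint continuation n : R -> R -> R :=
  if n is n'.+1 then
    trans (mu (T1 - n')) (f (T1 - n'))
      (stop_or_continue (T1 - n') (continuation n'))
  else lin K K.

Definition cont k : R -> R -> R := continuation (T1 - k).
Definition value k : R -> R -> R := stop_or_continue k (cont k).

Lemma contS k : (k < T1)%N -> cont k = trans (mu k.+1) (f k.+1) (value k.+1).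
Proof.
move=> kT; rewrite /value /cont; case E : (T1 - k)%N => [|n].
  by move/eqP: E; rewrite subn_eq0 leqNgt kT.
have En : (T1 - k.+1)%N = n by rewrite subnS E.
have Ek : (T1 - n)%N = k.+1 by rewrite -En subKn.
by rewrite /= Ek En.
Qed.

Lemma value_cont k a b : value k a b <= cont k a b.
Proof. exact: bigmin_le_id. Qed.

Lemma value_line k m a b : 0 <= a -> 0 <= b ->
  value k a b <= a * cost k m false + b * cost k m true.
Proof. by move=> a0 b0; rewrite -linE//; exact: bigmin_le. Qed.

Lemma value_attained k a b : 0 <= a -> 0 <= b ->
  value k a b = cont k a b \/
  exists m, value k a b = a * cost k m false + b * cost k m true.
Proof.
move=> a0 b0; rewrite /value /stop_or_continue.
elim/big_rec: _ => [|m v _ IH]; first by left.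
by rewrite minElt; case: ifP => _ //; right; exists m; rewrite linE.
Qed.

Lemma K_ge0 : 0 <= K.
Proof. by have /andP[c0] := cost_bnd 0 (Ordinal M_gt0) true; exact: le_trans. Qed.

Lemma regular_value_of_cont k : regular K (cont k) -> regular K (value k).
Proof.
move=> rC; rewrite /value /stop_or_continue.
suff reg (s : seq 'I_M) : regular K (fun a b => \big[Num.min/cont k a b]_(m <- s)
  lin (cost k m false) (cost k m true) a b) by exact: reg.
elim: s => [|m s IH].
  have -> // : (fun a b => \big[Num.min/cont k a b]_(m <- [::])
     lin (cost k m false) (cost k m true) a b) = cont k.
  by apply/funext => a; apply/funext => b; rewrite big_nil.
have -> : (fun a b => \big[Num.min/cont k a b]_(m <- m :: s)
     lin (cost k m false) (cost k m true) a b) =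
   (fun a b => Num.min (lin (cost k m false) (cost k m true) a b)
     (\big[Num.min/cont k a b]_(m <- s)
        lin (cost k m false) (cost k m true) a b)).
  by apply/funext => a; apply/funext => b; rewrite big_cons.
by apply: regular_min => //; exact: regular_lin.
Qed.

Lemma regular_cont k : regular K (cont k).
Proof.
have [n] := ubnP (T1 - k); elim: n => // n IH in k *; rewrite ltnS => kn.
have [kT|Tk] := ltnP k T1; last first.
  rewrite /cont (eqP (_ : (T1 - k)%N == 0)) ?subn_eq0//.
  by apply: regular_lin; rewrite K_ge0 lexx.
rewrite contS//; apply: regular_trans => //; last exact: K_ge0.
- by move=> h; exact: dens.
- apply: regular_value_of_cont; apply: IH.
  by rewrite subnS -ltnS prednK ?subn_gt0.
Qed.

Lemma regular_value k : regular K (value k).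
Proof. exact/regular_value_of_cont/regular_cont. Qed.

(** Once H = 1 is certain, observations bring no information, so the value is
    reached by deciding now on a message and on the time to send it. *)
Lemma value_false k : (k <= T1)%N ->
  exists k' m, [/\ (k <= k')%N, (k' <= T1)%N & cost k' m true <= value k 0 1].
Proof.
have [n] := ubnP (T1 - k); elim: n => // n IH in k *; rewrite ltnS => kn kT.
have [->|[m ->]] := value_attained k (lexx 0) ler01; last first.
  by exists k, m; rewrite mul0r mul1r add0r.
move: kT; rewrite leq_eqVlt => /predU1P[->|kT].
  exists T1, (Ordinal M_gt0); rewrite /cont subnn /= linE// mul0r mul1r add0r.
  by split=> //; case/andP: (cost_bnd T1 (Ordinal M_gt0) true).
rewrite contS// (trans_false _ (regular_value _) K_ge0); last by move=> h; exact: dens.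
have [||k' [m [kk' k'T le]]] := IH k.+1 => //.
  by rewrite subnS -ltnS prednK ?subn_gt0.
by exists k', m; rewrite ltnW.
Qed.

End Values.

(** * Optimal stages *)

Section StagePlan.
Context {R : realType} {d : measure_display} {T : measurableType d}.
Variables (mu : nat -> {sigma_finite_measure set T -> \bar R}).
Variables (f : nat -> bool -> T -> R).
Hypothesis dens : forall t h, (1 <= t)%N -> is_density (mu t) (f t h).
Variables (M T1 : nat) (M_gt0 : (0 < M)%N).
Variables (c1 : R) (resp : 'I_T1.+1 * 'I_M -> bool -> R) (K : R).
Hypothesis c1_ge0 : 0 <= c1.

(** Cost of stopping at time [k] with a message that O2 treats as the message
    [s.2] sent at time [s.1]. *)
Definition stop_cost (k : nat) (s : 'I_T1.+1 * 'I_M) (h : bool) : R :=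
  c1 * k%:R + resp s h.

(** [inord k] is [k] for every time up to [T1]; beyond, it keeps the costs
    bounded. *)
Definition msg_cost (k : nat) (m : 'I_M) (h : bool) : R :=
  stop_cost (inord k : 'I_T1.+1) (inord k, m) h.

Definition mix (c : bool -> R) (x : R) : R := x * c false + (1 - x) * c true.

Hypothesis cost_bnd : forall k m h, 0 <= msg_cost k m h <= K.

Local Notation V k x := (value mu f T1 msg_cost K k x (1 - x)).
Local Notation C k x := (cont mu f T1 msg_cost K k x (1 - x)).

(** Message [j] of the threshold rule is to be treated by O2 as the message
    [(s j).2] sent at time [(s j).1].  This time is [k], except at a stage where
    stopping is optimal at no belief. *)
Lemma stage_plan k : (1 <= k <= T1)%N ->
  exists (s : 'I_M -> 'I_T1.+1 * 'I_M) (alpha beta : nat -> R),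
  [/\ chained (M := M) alpha beta, forall j, (k <= (s j).1)%N,
      forall (j : 'I_M) x, 0 <= x <= 1 -> alpha j <= x <= beta j ->
        mix (stop_cost k (s j)) x <= V k x
    & forall x, 0 <= x <= 1 -> (exists j : 'I_M, alpha j <= x <= beta j) \/
        (k < T1)%N /\ C k x <= V k x].
Proof.
move=> /andP[k1 kT].
have ik : (inord k : 'I_T1.+1) = k :> nat by rewrite inordK.
have costE m h : msg_cost k m h = stop_cost k (inord k, m) h.
  by rewrite /msg_cost ik.
have regV := regular_value dens T1 cost_bnd M_gt0 k.
have V_line m (x : R) : 0 <= x <= 1 ->
    V k x <= x * msg_cost k m false + (1 - x) * msg_cost k m true.
  by move=> /andP[x0 x1]; apply: value_line => //; rewrite subr_ge0.
have V_att (x : R) : 0 <= x <= 1 -> V k x = C k x \/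
    exists m, V k x = x * msg_cost k m false + (1 - x) * msg_cost k m true.
  by move=> /andP[x0 x1]; apply: value_attained => //; rewrite subr_ge0.
have final (x : R) : k = T1 -> 0 <= x <= 1 ->
    exists m, x * msg_cost k m false + (1 - x) * msg_cost k m true <= V k x.
  move=> kE x01; have [->|[m ->]] := V_att x x01; last by exists m.
  case/andP: (x01) => x0 x1; exists (Ordinal M_gt0).
  have bd h : msg_cost T1 (Ordinal M_gt0) h <= K.
    by case/andP: (cost_bnd T1 (Ordinal M_gt0) h).
  rewrite /cont kE subnn /= linE ?subr_ge0//.
  by rewrite lerD// ler_wpM2l ?subr_ge0.
have [act|inact] := pselect (exists m, exists2 x : R, 0 <= x <= 1 &
    x * msg_cost k m false + (1 - x) * msg_cost k m true <= V k x).
  have [s [al [be [ch opt cov]]]] := optimal_chain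
    (fun x y => regular_lip regV) (fun x y t => regular_concave regV)
    V_line M_gt0 act.
  exists (fun j => (inord k, s j)), al, be; split=> // [j|j x x01 /opt|x x01].
  - by rewrite /= ik.
  - by rewrite /mix -!costE.
  - have [VC|[m VE]] := V_att x x01; last first.
      by left; apply: cov x01 _; rewrite VE.
    have [kltT|Tk] := ltnP k T1; first by right; rewrite VC.
    have /final : k = T1 by apply/eqP; rewrite eqn_leq kT Tk.
    by move=> /(_ x x01) [m mV]; left; apply: cov x01 mV.
have kltT : (k < T1)%N.
  rewrite ltn_neqAle kT andbT; apply/eqP => kE; apply: inact.
  have [|m mV] := final 0 kE; first by rewrite lexx ler01.
  by exists m, 0 => //; rewrite lexx ler01.
have VC x : 0 <= x <= 1 -> C k x <= V k x.
  move=> x01; have [->//|[m VE]] := V_att x x01.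
  by exfalso; apply: inact; exists m, x; rewrite ?VE.
(* No message is worth sending at any belief.  The forced transmission at
   belief 0 then announces a later message, chosen optimally for H = 1. *)
have [k' [m [kk' k'T mV]]] := value_false dens cost_bnd M_gt0 kT.
exists (fun=> (inord k', m)), (fun=> 0), (fun=> 0); split.
- by split=> //; rewrite ler01.
- by move=> j; rewrite /= inordK.
- move=> j x _ /le_anti <-; rewrite /mix mul0r add0r subr0 mul1r.
  apply: le_trans mV; rewrite /msg_cost /stop_cost inordK// lerD2r.
  by rewrite ler_wpM2l// ler_nat.
- by move=> x x01; right; split=> //; exact: VC.
Qed.

End StagePlan.

(** * Integrals split along finitely valued functions *)

Section Partition.
Context {R : realType} {d : measure_display} {T : measurableType d}.
Variables (P : {measure set T -> \bar R}) (U : finType) (Z : T -> U).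
Hypothesis mZ : forall u, measurable [set w | Z w = u].
Local Open Scope ereal_scope.

Lemma integral_partition (D : set T) (phi : T -> \bar R) : measurable D ->
  measurable_fun setT phi -> (forall w, 0 <= phi w) ->
  \int[P]_(w in D) phi w = \sum_u \int[P]_(w in D `&` [set w | Z w = u]) phi w.
Proof.
move=> mD mphi phi0.
transitivity (\int[P]_(w in D)
    \sum_(u <- index_enum U) (phi \_ [set w | Z w = u]) w).
  apply: eq_integral => w _.
  rewrite (bigD1 (Z w)) //= patchE mem_set// big1 ?adde0// => u uZ.
  by rewrite patchE memNset// => /= Zu; rewrite Zu eqxx in uZ.
rewrite ge0_integral_sum//.
- by apply: eq_bigr => u _; rewrite integral_mkcondr.
- move=> u; apply: measurable_funTS; apply/(measurable_restrictT _ _).1 => //.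
  exact: measurable_funTS.
- by move=> u w _; apply: erestrict_ge0.
Qed.

Lemma integral_finite_valued (F : U -> R) : (forall u, 0 <= F u)%R ->
  \int[P]_w (F (Z w))%:E = \sum_u (F u)%:E * P [set w | Z w = u].
Proof.
move=> F0; rewrite integral_partition//.
- apply: eq_bigr => u _; rewrite setTI -integral_cst//.
  by apply: eq_integral => w /[!inE] /= ->.
- move=> _ Y mY; rewrite setTI.
  have -> : (fun w => (F (Z w))%:E) @^-1` Y =
      \bigcup_(u in [set u | Y (F u)%:E]) [set w | Z w = u].
    apply/seteqP; split=> [w Yw|w [u Yu Zu]]; first by exists (Z w).
    by rewrite /= (Zu : Z w = u).
  apply: fin_bigcup_measurable => // u _; exact: mZ.
- by move=> w; rewrite lee_fin.
Qed.

End Partition.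

(** * Histories *)

Section History.
Context {R : realType} {dW d : measure_display}.
Context {Omega : measurableType dW} {Obs : measurableType d}.
Variables (P : probability Omega R) (Y : nat -> {RV P >-> Obs}).

Let measurable_history t : measurable_fun setT (history Y t).
Proof.
apply/measurable_fun_tnthP => i.
rewrite (_ : _ \o _ = Y i.+1) //.
by apply/funext => w; rewrite /= tnth_mktuple.
Qed.

Definition hist t : {mfun Omega >-> t.-tuple Obs} :=
  HB.pack_for {mfun Omega >-> t.-tuple Obs} (history Y t)
    (isMeasurableFun.Build _ _ _ _ (history Y t) (@measurable_history t)).

Definition truncate s t (le : (s <= t)%N) (y : t.-tuple Obs) : s.-tuple Obs :=
  [tuple tnth y (widen_ord le i) | i < s].

Lemma measurable_truncate s t (le : (s <= t)%N) :
  measurable_fun setT (truncate le).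
Proof.
apply/measurable_fun_tnthP => i.
rewrite (_ : _ \o _ = @tnth _ Obs ^~ (widen_ord le i)); first exact: measurable_tnth.
by apply/funext => y; rewrite /= tnth_mktuple.
Qed.

Lemma truncate_hist s t (le : (s <= t)%N) w : truncate le (hist t w) = hist s w.
Proof. by apply: eq_from_tnth => i; rewrite !tnth_mktuple. Qed.

Lemma hist_box t (A : 'I_t -> set Obs) w :
  (hist t @^-1` box A) w <-> forall i : 'I_t, A i (Y i.+1 w).
Proof. by split=> Aw i; have := Aw i; rewrite tnth_mktuple. Qed.

Definition observed t : set (set Omega) :=
  [set E | exists2 A, measurable A & E = hist t @^-1` A].

Lemma observed_measurable t E : observed t E -> measurable E.
Proof. by move=> [A mA ->]; exact: measurable_funPTI. Qed.

Lemma observed_le s t E : (s <= t)%N -> observed s E -> observed t E.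
Proof.
move=> st [A mA ->]; exists (truncate st @^-1` A).
  by rewrite -[X in measurable X]setTI; exact: measurable_truncate.
apply/seteqP; split=> w /=; first by rewrite truncate_hist.
by have := truncate_hist st w => /= ->.
Qed.

(** The event is a finite union of finite intersections of level sets of the
    functions [F i]. *)
Lemma observed_saturated t (I U : finType) (F : I -> Omega -> U) (Q : set Omega) :
  (forall i u, observed t [set w | F i w = u]) ->
  (forall w w', (forall i, F i w = F i w') -> Q w -> Q w') -> observed t Q.
Proof.
move=> Fobs Qsat.
have /choice[B BP] iu : exists B : set (t.-tuple Obs), measurable B /\
    [set w | F iu.1 w = iu.2] = hist t @^-1` B.
  by have [B mB BE] := Fobs iu.1 iu.2; exists B.
pose patterns := [set v : {ffun I -> U} | exists2 w, Q w & forall i, F i w = v i].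
exists (\bigcup_(v in patterns) \bigcap_(i in setT) B (i, v i)).
  apply: fin_bigcup_measurable => // v _; apply: fin_bigcap_measurable => [|i _].
    exact: finite_finset.
  by case: (BP (i, v i)).
apply/seteqP; split=> [w Qw|w [v [w' Qw' vE] Bw]].
  exists [ffun i => F i w]; first by exists w => // i; rewrite ffunE.
  move=> i _; have [_ /(congr1 (@^~ w)) /= BE] := BP (i, [ffun i => F i w] i).
  by rewrite -BE ffunE.
apply: Qsat Qw' => i; have [_ /(congr1 (@^~ w)) /= BE] := BP (i, v i).
by rewrite vE; apply/esym; rewrite BE; exact: Bw.
Qed.

End History.

(** * Conditional independence of the histories *)

Section Independence.
Context {R : realType} {dW d1 d2 : measure_display}.
Context {Omega : measurableType dW}.
Context {Obs1 : measurableType d1} {Obs2 : measurableType d2}.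
Variables (P : probability Omega R).
Local Open Scope ereal_scope.

(** The form in which independence extends from boxes to all events, with the
    constants standing for probabilities that are not divided out. *)
Lemma sub_law_scaled n d (T : measurableType d) (X : {mfun Omega >-> n.-tuple T})
    (E F : set Omega) (a b : R) :
  measurable E -> measurable F -> (0 <= a)%R -> (0 <= b)%R ->
  (forall A : 'I_n -> set T, (forall i, measurable (A i)) ->
     a%:E * P (E `&` X @^-1` box A) = b%:E * P (F `&` X @^-1` box A)) ->
  forall A, measurable A ->
     a%:E * P (E `&` X @^-1` A) = b%:E * P (F `&` X @^-1` A).
Proof.
move=> mE mF a0 b0 boxE A mA.
apply: (box_unique (m1 := mscale (NngNum a0) (sub_law P mE X))
  (m2 := mscale (NngNum b0) (sub_law P mF X))) => //.
by rewrite /mscale /=; apply: lte_mul_pinfty => //; exact: sub_law_lty.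
Qed.

Variables (H : {RV P >-> bool}).
Variables (Y1 : nat -> {RV P >-> Obs1}) (Y2 : nat -> {RV P >-> Obs2}).
Variables (mu1 : nat -> {sigma_finite_measure set Obs1 -> \bar R}).
Variables (mu2 : nat -> {sigma_finite_measure set Obs2 -> \bar R}).
Variables (f1 : nat -> bool -> Obs1 -> R) (f2 : nat -> bool -> Obs2 -> R).
Hypothesis dens1 : forall t h, (1 <= t)%N -> is_density (mu1 t) (f1 t h).
Hypothesis indep : cond_independent_with_densities H Y1 Y2 mu1 mu2 f1 f2.

Let mhist1 n A : measurable A -> measurable (hist Y1 n @^-1` A).
Proof. by move=> mA; exact: measurable_funPTI. Qed.
Let mhist2 n A : measurable A -> measurable (hist Y2 n @^-1` A).
Proof. by move=> mA; exact: measurable_funPTI. Qed.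

Let box_prob h n1 n2 (A : 'I_n1 -> set Obs1) (B : 'I_n2 -> set Obs2) :
  (forall i, measurable (A i)) -> (forall j, measurable (B j)) ->
  P (hyp H h `&` hist Y2 n2 @^-1` box B `&` hist Y1 n1 @^-1` box A) =
  P (hyp H h) * (\prod_(i < n1) \int[mu1 i.+1]_(y in A i) (f1 i.+1 h y)%:E)
   * (\prod_(j < n2) \int[mu2 j.+1]_(y in B j) (f2 j.+1 h y)%:E).
Proof.
move=> mA mB; rewrite -(indep _ mA mB); congr (P _).
apply/seteqP; split=> [w [[Hw /hist_box Bw] /hist_box Aw]|w [Hw Aw Bw]] //.
by split; [split=> //; exact/hist_box|exact/hist_box].
Qed.

Let box0 d (T : measurableType d) (Y : nat -> {RV P >-> T}) (A : 'I_0 -> set T) :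
  hist Y 0 @^-1` box A = setT.
Proof. by apply/seteqP; split=> // w _; apply/hist_box => -[]. Qed.

Lemma hist_next_indep h k A B : measurable A -> measurable B ->
  P (hyp H h `&` (hist Y1 k @^-1` A `&` Y1 k.+1 @^-1` B)) =
  P (hyp H h `&` hist Y1 k @^-1` A) * \int[mu1 k.+1]_(y in B) (f1 k.+1 h y)%:E.
Proof.
move=> mA mB; have [mf f0 f_int] := dens1 h (ltn0Sn k).
have mfE D : measurable_fun D (fun y => (f1 k.+1 h y)%:E).
  by apply: measurable_funTS; exact/measurable_EFinP.
have int0 : 0 <= \int[mu1 k.+1]_(y in B) (f1 k.+1 h y)%:E.
  by apply: integral_ge0 => y _; rewrite lee_fin.
have fin : \int[mu1 k.+1]_(y in B) (f1 k.+1 h y)%:E \is a fin_num.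
  rewrite ge0_fin_numE//; apply: (@le_lt_trans _ _ 1); last exact: ltry.
  rewrite -f_int; apply: ge0_subset_integral => //.
  by move=> y _; rewrite lee_fin.
have mYB : measurable (Y1 k.+1 @^-1` B) by exact: measurable_funPTI.
rewrite setIA setIAC.
suff : 1%:E * P (hyp H h `&` Y1 k.+1 @^-1` B `&` hist Y1 k @^-1` A) =
    (fine (\int[mu1 k.+1]_(y in B) (f1 k.+1 h y)%:E))%:E *
    P (hyp H h `&` hist Y1 k @^-1` A) by rewrite mul1e fineK// muleC.
apply: sub_law_scaled mA => [||//||D mD].
- by apply: measurableI => //; exact: measurable_hyp.
- exact: measurable_hyp.
- exact: fine_ge0.
 rewrite mul1e fineK//.
pose D' (i : 'I_k.+1) := if insub (i : nat) is Some j then D j else B.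
have mD' i : measurable (D' i) by rewrite /D'; case: insub.
pose C0 := fun _ : 'I_0 => [set: Obs2].
have mC0 i : measurable (C0 i) by exact: measurableT.
have := box_prob h mD' mC0; rewrite box0 setIT big_ord0 mule1 big_ord_recr /= => bD'.
have := box_prob h mD mC0; rewrite box0 setIT big_ord0 mule1 => ->.
have D'max : D' ord_max = B by rewrite /D' insubF //= ltnn.
have D'w i : D' (widen_ord (leqnSn k) i) = D i.
  by rewrite /D' (_ : insub _ = Some i) //; exact: valK.
move: bD'; rewrite D'max; under eq_bigr => i _ do rewrite D'w.
rewrite muleA [RHS]muleC => <-; congr (P _).
rewrite -setIA; congr (_ `&` _); apply/seteqP; split=> w.
  move=> [Bw /hist_box Dw]; apply/hist_box => i; rewrite /D'.
  case: insubP => [j _ ji|]; first by rewrite -ji; exact: Dw.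
  rewrite -leqNgt => ki; have -> : (i : nat) = k.
    by apply/eqP; rewrite eqn_leq ki -ltnS ltn_ord.
  exact: Bw.
move=> /hist_box Dw; split.
  by have := Dw ord_max; rewrite D'max.
by apply/hist_box => i; have := Dw (widen_ord (leqnSn k) i); rewrite D'w.
Qed.

(** Stated without dividing by the probability of the hypothesis. *)
Lemma hist_indep h n1 n2 A B : measurable A -> measurable B ->
  P (hyp H h) * P (hyp H h `&` hist Y2 n2 @^-1` B `&` hist Y1 n1 @^-1` A) =
  P (hyp H h `&` hist Y2 n2 @^-1` B) * P (hyp H h `&` hist Y1 n1 @^-1` A).
Proof.
move=> mA mB; have mh := measurable_hyp H h.
have fin E : measurable E -> P E = (fine (P E))%:E.
  by move=> mE; rewrite fineK//; exact: fin_num_measure.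
have mhB B' : measurable B' -> measurable (hyp H h `&` hist Y2 n2 @^-1` B').
  by move=> mB'; apply: measurableI => //; exact: mhist2.
have mhA A' : measurable A' -> measurable (hyp H h `&` hist Y1 n1 @^-1` A').
  by move=> mA'; apply: measurableI => //; exact: mhist1.
have boxes (D : 'I_n1 -> set Obs1) (C : 'I_n2 -> set Obs2) :
    (forall i, measurable (D i)) -> (forall i, measurable (C i)) ->
    P (hyp H h) * P (hyp H h `&` hist Y2 n2 @^-1` box C `&` hist Y1 n1 @^-1` box D) =
    P (hyp H h `&` hist Y2 n2 @^-1` box C) * P (hyp H h `&` hist Y1 n1 @^-1` box D).
  move=> mD mC.
  have mD0 (i : 'I_0) : measurable [set: Obs1] by [].
  have mC0 (i : 'I_0) : measurable [set: Obs2] by [].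
  rewrite (box_prob h mD mC).
  have := box_prob h mD0 mC; rewrite box0 setIT big_ord0 mule1 => ->.
  have := box_prob h mD mC0; rewrite box0 setIT big_ord0 mule1 => ->.
  by rewrite [RHS]muleC muleCA.
have boxA (C : 'I_n2 -> set Obs2) : (forall i, measurable (C i)) ->
    P (hyp H h) * P (hyp H h `&` hist Y2 n2 @^-1` box C `&` hist Y1 n1 @^-1` A) =
    P (hyp H h `&` hist Y2 n2 @^-1` box C) * P (hyp H h `&` hist Y1 n1 @^-1` A).
  move=> mC; have mBC := mhB _ (measurable_box mC).
  rewrite (fin _ mh) (fin _ mBC).
  apply: sub_law_scaled mA; rewrite ?fine_ge0// => D mD.
  by rewrite -!fin//; exact: boxes.
rewrite setIAC [RHS]muleC (fin _ mh) (fin _ (mhA _ mA)).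
apply: sub_law_scaled mB; rewrite ?fine_ge0//; first exact: mhA.
move=> C mC; rewrite -!fin//; last exact: mhA.
by rewrite setIAC boxA// muleC.
Qed.

End Independence.

(** * Versions of the belief with values in [0, 1] *)

Section ClipBelief.
Context {R : realType} {dW d : measure_display}.
Context {Omega : measurableType dW} {T : measurableType d}.
Variables (P : probability Omega R) (E : set Omega) (mE : measurable E).
Variables (X : {mfun Omega >-> T}) (pi : T -> R).
Hypothesis mpi : measurable_fun setT pi.
Local Open Scope ereal_scope.
Hypothesis piE : forall A, measurable A ->
  P (E `&` X @^-1` A) = \int[P]_(w in X @^-1` A) (pi (X w))%:E.

Definition clip (x : R) : R := Num.max 0%R (Num.min 1%R x).

Lemma clip01 x : (0 <= clip x <= 1)%R.
Proof. by rewrite le_max lexx ge_max ler01 ge_min lexx. Qed.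

Lemma clip_id x : (0 <= x <= 1)%R -> clip x = x.
Proof. by move=> /andP[x0 x1]; rewrite /clip min_r// max_r. Qed.

Let mXpi D : measurable_fun D (fun w => (pi (X w))%:E).
Proof.
by apply: measurable_funTS; apply/measurable_EFinP; exact: measurableT_comp.
Qed.

Let null_set (A : set T) (g : T -> R) : measurable A -> measurable_fun setT g ->
  (forall z, A z -> (0 < g z)%R) ->
  \int[P]_(w in X @^-1` A) (g (X w))%:E <= 0 -> {ae P, forall w, ~ A (X w)}.
Proof.
move=> mA mg g0 int_le0.
have mXA : measurable (X @^-1` A) by exact: measurable_funPTI.
have mgX : measurable_fun (X @^-1` A) (fun w => (g (X w))%:E).
  by apply: measurable_funTS; apply/measurable_EFinP; exact: measurableT_comp.
have /ae_eq_integral_abs : \int[P]_(w in X @^-1` A) `|(g (X w))%:E| = 0.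
  apply/eqP; rewrite eq_le integral_ge0 ?andbT//.
  under eq_integral => w /[!inE] Aw do rewrite gee0_abs ?lee_fin ?ltW ?g0//.
  exact: int_le0.
move=> /(_ mXA mgX); apply: filterS => w gw Aw.
by have := g0 _ Aw; have [->] := gw Aw; rewrite ltxx.
Qed.

(** On the event that the belief is negative its integral is a probability,
    hence nonnegative; on the event that it exceeds 1 its integral is at most
    the probability of that event.  So both events are negligible. *)
Lemma belief_ae01 : {ae P, forall w, (0 <= pi (X w) <= 1)%R}.
Proof.
have mlt (u v : T -> R) : measurable_fun setT u -> measurable_fun setT v ->
    measurable [set z | (u z < v z)%R].
  move=> mu mv; rewrite -[X in measurable X]setTI.
  by have := measurable_fun_ltr mu mv; move=> /(_ measurableT [set true]); apply.
have neg : {ae P, forall w, ~ (pi (X w) < 0)%R}.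
  apply: (null_set (mlt _ (cst 0%R) mpi (measurable_cst _))
    (g := fun z => (- pi z)%R)) => [|z|].
  - exact: measurableT_comp.
  - by rewrite /= oppr_gt0.
  - rewrite -leeN2 oppe0 -integral_ge0N; last first.
      by move=> w /= w0; rewrite lee_fin oppr_ge0 ltW.
    under eq_integral do rewrite -EFinN opprK.
    by rewrite -piE// ?measure_ge0//; exact: mlt.
have big : {ae P, forall w, ~ (1 < pi (X w))%R}.
  have mA := mlt (cst 1%R) _ (measurable_cst _) mpi.
  have mXA : measurable (X @^-1` [set z | (cst 1 z < pi z)%R]).
    exact: measurable_funPTI.
  apply: (null_set mA (g := fun z => (pi z - 1)%R)) => [|z|].
  - exact: measurable_funB.
  - by rewrite /= subr_gt0.
  - set S := X @^-1` _ in mXA *.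
    have PS : \int[P]_(w in S) (cst 1 w) = P S by rewrite integral_cst// mul1e.
    have fin : P S \is a fin_num by exact: fin_num_measure.
    rewrite -[leLHS](addeK _ fin) sube_le0// -[X in _ + X]PS -ge0_integralD//.
    + under eq_integral do rewrite -EFinD subrK.
      rewrite -piE//; apply: le_measure; rewrite ?inE//.
      exact: measurableI.
    + by move=> w /= w1; rewrite lee_fin subr_ge0 ltW.
    + apply: measurable_funTS; apply/measurable_EFinP; apply: measurable_funB => //.
      exact: measurableT_comp.
apply: filterS2 neg big => w w0 w1.
by apply/andP; split; rewrite leNgt; apply/negP.
Qed.

Lemma clip_belief A : measurable A ->
  P (E `&` X @^-1` A) = \int[P]_(w in X @^-1` A) (clip (pi (X w)))%:E.
Proof.
move=> mA; rewrite piE//; apply: ae_eq_integral => //.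
- exact: measurable_funPTI.
- apply: measurable_funTS; apply/measurable_EFinP; apply: measurable_maxr => //.
  by apply: measurable_minr => //; exact: measurableT_comp.
- by apply: filterS belief_ae01 => w w01 _; rewrite clip_id.
Qed.

End ClipBelief.

(** * Expected cost as a function of O1's stopping time and message *)

Lemma first_timeP s T (p : pred nat) : (s <= T)%N -> p T ->
  [/\ (s <= first_time s T p)%N, (first_time s T p <= T)%N, p (first_time s T p)
    & forall u, (s <= u)%N -> (u < first_time s T p)%N -> ~~ p u].
Proof.
move=> sT pT; rewrite /first_time.
case: arg_minnP => [|i /andP[si pi] imin]; first by rewrite /= sT.
split=> //; first by rewrite -ltnS.
move=> u su ui; apply/negP => pu.
have uT : (u < T.+1)%N by rewrite (ltn_trans ui).
by have := imin (Ordinal uT); rewrite /= su pu leqNgt ui => /(_ isT).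
Qed.

Lemma first_time_le s T (p : pred nat) : (first_time s T p < T.+1)%N.
Proof. exact: ltn_ord. Qed.

Section Reduction.
Context {R : realType} {dW d1 d2 : measure_display}.
Context {Omega : measurableType dW}.
Context {Obs1 : measurableType d1} {Obs2 : measurableType d2}.
Variables (P : probability Omega R) (H : {RV P >-> bool}).
Variables (Y1 : nat -> {RV P >-> Obs1}) (Y2 : nat -> {RV P >-> Obs2}).
Variables (mu1 : nat -> {sigma_finite_measure set Obs1 -> \bar R}).
Variables (mu2 : nat -> {sigma_finite_measure set Obs2 -> \bar R}).
Variables (f1 : nat -> bool -> Obs1 -> R) (f2 : nat -> bool -> Obs2 -> R).
Hypothesis indep : cond_independent_with_densities H Y1 Y2 mu1 mu2 f1 f2.
Variables (prob : problem) (M T1 T2 : nat).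
Hypotheses (M_gt0 : (0 < M)%N) (T1_gt0 : (0 < T1)%N).
Variables (c1 c2 : R) (J : bool -> bool -> R).
Hypotheses (c1_ge0 : 0 <= c1) (c2_ge0 : 0 <= c2) (J_ge0 : forall u h, 0 <= J u h).

(** A stopping time of O1 and the message sent then. *)
Local Notation signal := ('I_T1.+1 * 'I_M)%type.

Definition transcript (s : signal) : seq (option 'I_M) :=
  rcons (nseq s.1.-1 None) (Some s.2).

(** In the second problem O2 acts while the transcript is still arriving. *)
Definition seen t (z : seq (option 'I_M)) : seq (option 'I_M) :=
  match prob with P1 => z | P2 => take t z end.

Definition signal_of (g1 : policy1 Obs1 M) (w : Omega) : signal :=
  (inord (tau1 Y1 T1 g1 w),
   odflt (Ordinal M_gt0) (message Y1 g1 w (tau1 Y1 T1 g1 w))).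

Definition reply (g2 : policy2 Obs2 M) (w : Omega) (s : signal) (t : nat) :=
  g2 t (history Y2 t w) (seen t (transcript s)).

(** O2's stopping time and decision if O1's signal were [s]: as a function of
    [s], this table depends on the observations of O2 only. *)
Definition response (g2 : policy2 Obs2 M) (w : Omega) (s : signal) :
    'I_T2.+1 * option bool :=
  let t := first_time (match prob with P1 => 0 | P2 => 1 end) T2
    (fun t => isSome (reply g2 w s t)) in
  (inord t, reply g2 w s t).

Definition response_cost (r : 'I_T2.+1 * option bool) (h : bool) : R :=
  c2 * r.1%:R + (if r.2 is Some u then J u h else 0).

Lemma tau1P (g1 : policy1 Obs1 M) w : admissible1 T1 g1 ->
  [/\ (1 <= tau1 Y1 T1 g1 w)%N, (tau1 Y1 T1 g1 w <= T1)%N,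
      exists m, message Y1 g1 w (tau1 Y1 T1 g1 w) = Some m
    & forall u, (1 <= u)%N -> (u < tau1 Y1 T1 g1 w)%N ->
        message Y1 g1 w u = None].
Proof.
move=> [_ gT].
have [|t1 tT mt before] :=
    @first_timeP 1 T1 (fun t => isSome (message Y1 g1 w t)) T1_gt0.
  by rewrite /message; move: (gT (history Y1 T1 w)); case: (g1 T1 _).
split=> //; first by move: mt; case: (message _ _ _ _) => // m _; exists m.
by move=> u u1 ut; have := before u u1 ut; case: (message _ _ _ _).
Qed.

Lemma signal_of_eq (g1 : policy1 Obs1 M) w (s : signal) : admissible1 T1 g1 ->
  (signal_of g1 w = s) <->
  [/\ (1 <= s.1)%N, message Y1 g1 w s.1 = Some s.2
    & forall u, (1 <= u)%N -> (u < s.1)%N -> message Y1 g1 w u = None].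
Proof.
move=> adm; have [t1 tT [m mt] before] := tau1P w adm.
have sE : signal_of g1 w = (inord (tau1 Y1 T1 g1 w), m) by rewrite /signal_of mt.
have tE : (inord (tau1 Y1 T1 g1 w) : 'I_T1.+1) = tau1 Y1 T1 g1 w :> nat.
  by rewrite inordK.
split=> [<-|[s1 ms bs]]; first by rewrite sE /= tE.
have ts : tau1 Y1 T1 g1 w = s.1.
  apply/eqP; rewrite eqn_leq; apply/andP; split; rewrite leqNgt; apply/negP => lt.
    by rewrite before in ms.
  by rewrite bs in mt.
rewrite sE; case: s s1 ms bs ts => k m' /= k1 ms bs ts; congr pair.
  by apply/val_inj; rewrite /= tE.
by move: mt; rewrite ts ms => -[].
Qed.

Lemma received_signal (g1 : policy1 Obs1 M) w t : admissible1 T1 g1 ->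
  received Y1 prob T1 g1 w t = seen t (transcript (signal_of g1 w)).
Proof.
move=> adm; have [t1 tT [m mt] before] := tau1P w adm.
have tr : messages Y1 g1 w (tau1 Y1 T1 g1 w) = transcript (signal_of g1 w).
  rewrite /transcript /signal_of mt /= inordK//.
  move: t1 mt before; case: (tau1 Y1 T1 g1 w) => // n _ mt before.
  rewrite /messages -[n.+1]addn1 iotaD map_cat /= add1n mt -cats1; congr (_ ++ _).
  rewrite addn1 /=; apply: (@eq_from_nth _ None); rewrite !size_map ?size_iota ?size_nseq//.
  move=> i iN; rewrite (nth_map 0%N) ?size_iota// nth_iota// nth_nseq iN.
  by rewrite before// add1n ltnS.
rewrite /received /seen; case: prob; first exact: tr.
by rewrite -tr /messages -map_take take_iota.
Qed.

(** Since O2 knows when a message was sent, the reinterpretation [sigma] may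
    depend on that time, and may even change it. *)
Definition mimics (sigma : signal -> signal) (g2' g2 : policy2 Obs2 M) : Prop :=
  forall (s : signal) t y, (1 <= s.1)%N ->
    g2' t y (seen t (transcript s)) = g2 t y (seen t (transcript (sigma s))).

(** A signal may be reinterpreted as a later one, as O2 then only has to go on
    pretending that O1 is silent. *)
Lemma mimic_exists (sigma : signal -> signal) (g2 : policy2 Obs2 M) :
  (forall s : signal, (s.1 <= (sigma s).1)%N) -> admissible2 T2 g2 ->
  exists2 g2', admissible2 T2 g2' & mimics sigma g2' g2.
Proof.
move=> later [mg gT].
pose decode (z : seq (option 'I_M)) : option signal :=
  let k := find isSome z in
  omap (fun m => (inord k.+1, m)) (nth None z k).
pose g2' t y z := g2 t y
  (if decode z is Some s then seen t (transcript (sigma s)) else z).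
exists g2'; first by split=> [t z a|y z]; [exact: mg|exact: gT].
have blank n : decode (nseq n None) = None.
  by rewrite /decode nth_nseq; case: ifP.
have sent (s : signal) : (1 <= s.1)%N -> decode (transcript s) = Some s.
  case: s => k m /= k1; rewrite /decode /transcript /=.
  have -> : find isSome (rcons (nseq k.-1 None) (Some m)) = k.-1.
    rewrite -cats1 find_cat /= has_nseq andbF size_nseq /= addn0 //.
  rewrite nth_rcons size_nseq ltnn eqxx /= prednK//; congr (Some (_, _)).
  by apply/val_inj; rewrite /= inordK.
move=> s t y s1; rewrite /g2'; congr (g2 t y _).
case Eprob : prob; rewrite /seen Eprob /=; first by rewrite sent.
have [tk|kt] := ltnP t s.1.
  have take_blank (s' : signal) : (s.1 <= s'.1)%N ->
      take t (transcript s') = nseq t None.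
    move=> ss'; have ts' : (t <= s'.1.-1)%N.
      by rewrite -ltnS (ltn_predK (leq_trans tk ss')) (leq_trans tk ss').
    by rewrite /transcript -cats1 takel_cat ?size_nseq// take_nseq.
  by rewrite !take_blank// blank.
rewrite take_oversize ?sent//.
by rewrite size_rcons size_nseq prednK.
Qed.

Lemma total_costE sigma (g1 : policy1 Obs1 M) (g2 g2' : policy2 Obs2 M) w :
  admissible1 T1 g1 -> mimics sigma g2' g2 ->
  total_cost H Y1 Y2 prob T1 T2 g1 g2' c1 c2 J w =
  c1 * (signal_of g1 w).1%:R +
  response_cost (response g2 w (sigma (signal_of g1 w))) (H w).
Proof.
move=> adm mim; have [t1 tT [m mt] before] := tau1P w adm.
have dec t : decision Y1 Y2 prob T1 g1 g2' w t =
    reply g2 w (sigma (signal_of g1 w)) t.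
  rewrite /decision received_signal// mim//.
  by case/(signal_of_eq w _ adm): (erefl (signal_of g1 w)).
have tau2E : tau2 Y1 Y2 prob T1 T2 g1 g2' w = first_time
    (match prob with P1 => 0 | P2 => 1 end) T2
    (fun t => isSome (reply g2 w (sigma (signal_of g1 w)) t)).
  by rewrite /tau2; congr first_time; apply/funext => t; rewrite dec.
have sE : (signal_of g1 w).1 = tau1 Y1 T1 g1 w :> nat by rewrite /= inordK.
rewrite /total_cost sE tau2E dec /response_cost /response /=.
by rewrite inordK ?first_time_le// addrA.
Qed.

Lemma signal_observed (g1 : policy1 Obs1 M) s : admissible1 T1 g1 ->
  observed Y1 T1 [set w | signal_of g1 w = s].
Proof.
move=> adm; case: (adm) => mg _.
apply: (observed_saturated (F := fun (i : 'I_T1.+1) w => message Y1 g1 w i)).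
  move=> i a; apply: (@observed_le _ _ _ _ _ _ _ i); first by rewrite -ltnS.
  by exists [set y | g1 i y = a]; [exact: mg|].
move=> w w' eqw /= <-.
have E : tau1 Y1 T1 g1 w = tau1 Y1 T1 g1 w'.
  rewrite /tau1 /first_time; congr nat_of_ord; rewrite /arg_min /extremum.
  congr (odflt _ _); apply: eq_pick => i /=; rewrite eqw; congr (_ && _).
  by apply: eq_forallb => j /=; rewrite eqw.
rewrite /signal_of -E.
by rewrite -[tau1 _ _ _ _]/(nat_of_ord (Ordinal (first_time_le _ _ _))) eqw.
Qed.

Local Notation table := {ffun signal -> 'I_T2.+1 * option bool}.

Definition response_table (g2 : policy2 Obs2 M) (w : Omega) : table :=
  [ffun s => response g2 w s].

Lemma response_observed (g2 : policy2 Obs2 M) r : admissible2 T2 g2 ->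
  observed Y2 T2 [set w | response_table g2 w = r].
Proof.
move=> [mg _].
apply: (observed_saturated
  (F := fun (i : 'I_T2.+1 * signal) w => reply g2 w i.2 i.1)).
  move=> [t s] a; apply: (@observed_le _ _ _ _ _ _ _ t); first by rewrite -ltnS.
  by exists [set y | g2 t y (seen t (transcript s)) = a]; [exact: mg|].
move=> w w' eqw /= <-; apply/ffunP => s; rewrite !ffunE /response.
set t := first_time _ _ _; set t' := first_time _ _ _.
have E : t' = t.
  rewrite /t' /t /first_time; congr nat_of_ord; rewrite /arg_min /extremum.
  congr (odflt _ _); apply: eq_pick => i /=; rewrite (eqw (i, s)); congr (_ && _).
  by apply: eq_forallb => j /=; rewrite (eqw (j, s)).
rewrite E; congr pair.
exact: esym (eqw (Ordinal (first_time_le _ _ _), s)).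
Qed.

Local Open Scope ereal_scope.

(** Conditional probability given the hypothesis, and 0 for a hypothesis of
    probability 0. *)
Definition table_prob (g2 : policy2 Obs2 M) h (r : table) : R :=
  (fine (P (hyp H h `&` [set w | response_table g2 w = r])) / fine (P (hyp H h)))%R.

Definition mean_response (g2 : policy2 Obs2 M) (s : signal) (h : bool) : R :=
  (\sum_(r : table) response_cost (r s) h * table_prob g2 h r)%R.

Lemma response_cost_ge0 r h : (0 <= response_cost r h)%R.
Proof. by rewrite addr_ge0 ?mulr_ge0//; case: r.2. Qed.

Lemma mean_response_ge0 (g2 : policy2 Obs2 M) s h : (0 <= mean_response g2 s h)%R.
Proof.
apply: sumr_ge0 => r _; rewrite mulr_ge0 ?response_cost_ge0//.
by rewrite divr_ge0// fine_ge0// measure_ge0.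
Qed.

Let mtable (g2 : policy2 Obs2 M) r : admissible2 T2 g2 ->
  measurable [set w | response_table g2 w = r].
Proof. by move=> /(response_observed r)/observed_measurable. Qed.

Let msignal (g1 : policy1 Obs1 M) s : admissible1 T1 g1 ->
  measurable [set w | signal_of g1 w = s].
Proof. by move=> /(signal_observed s)/observed_measurable. Qed.

Let fin E : measurable E -> P E = (fine (P E))%:E.
Proof. by move=> mE; rewrite fineK//; exact: fin_num_measure. Qed.

(** Given the hypothesis, O1's signal and O2's response table are independent, so
    the table can be averaged out first. *)
Lemma expected_costE sigma (g1 : policy1 Obs1 M) (g2 g2' : policy2 Obs2 M) :
  admissible1 T1 g1 -> admissible2 T2 g2 -> mimics sigma g2' g2 ->
  expected_cost H Y1 Y2 prob T1 T2 g1 g2' c1 c2 J =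
  \sum_(s : signal) \sum_(h : bool) (c1 * s.1%:R + mean_response g2 (sigma s) h)%:E *
    P (hyp H h `&` [set w | signal_of g1 w = s]).
Proof.
move=> adm1 adm2 mim; rewrite /expected_cost unlock.
pose Z w := (signal_of g1 w, H w, response_table g2 w).
pose F (u : signal * bool * table) : R :=
  (c1 * u.1.1.1%:R + response_cost (u.2 (sigma u.1.1)) u.1.2)%R.
have ZE s h r : [set w | Z w = (s, h, r)] =
    hyp H h `&` [set w | response_table g2 w = r] `&` [set w | signal_of g1 w = s].
  apply/seteqP; split=> [w [<- <- <-]//|w [[/= Hw rw] sw]].
  by rewrite /Z Hw rw sw.
have mh := measurable_hyp H.
have mhr h r : measurable (hyp H h `&` [set w | response_table g2 w = r]).
  by apply: measurableI => //; exact: mtable.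
have mhs h s : measurable (hyp H h `&` [set w | signal_of g1 w = s]).
  by apply: measurableI => //; exact: msignal.
have mZ u : measurable [set w | Z w = u].
  by case: u => [[s h] r]; rewrite ZE; apply: measurableI => //; exact: msignal.
transitivity (\int[P]_w (F (Z w))%:E).
  by apply: eq_integral => w _; rewrite (total_costE w adm1 mim) /F /= ffunE.
rewrite integral_finite_valued//; last first.
  by move=> u; rewrite addr_ge0 ?mulr_ge0// response_cost_ge0.
have -> (G : signal * bool * table -> \bar R) :
    \sum_u G u =
    \sum_(s : signal) \sum_(h : bool) \sum_(r : table) G (s, h, r).
  rewrite pair_bigA /= pair_bigA /=; apply: eq_bigr => -[[s h] r] _ //.
apply: eq_bigr => s _; apply: eq_bigr => h _.
set Ps := P (hyp H h `&` [set w | signal_of g1 w = s]).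
have joint r : P (hyp H h `&` [set w | response_table g2 w = r] `&`
    [set w | signal_of g1 w = s]) = (table_prob g2 h r)%:E * Ps.
  have [A mA AE] := signal_observed s adm1.
  have [B mB BE] := response_observed r adm2.
  have := hist_indep indep h mA mB; rewrite -AE -BE.
  rewrite (fin (mh h)) (fin (mhr h r)) /Ps (fin (mhs h s)) -EFinM.
  rewrite (fin (measurableI _ _ (mhr h r) (msignal s adm1))) => -[E].
  rewrite -EFinM; congr _%:E; rewrite /table_prob mulrAC -E.
  have [p0|p0] := eqVneq (fine (P (hyp H h))) 0%R; last by rewrite mulrC mulKf.
  rewrite p0 invr0 mulr0; apply/eqP; rewrite eq_le fine_ge0 ?measure_ge0// andbT.
  rewrite -p0 fine_le//; [|by apply: fin_num_measure|].
    by apply: fin_num_measure; apply: measurableI => //; exact: msignal.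
  apply: le_measure; rewrite ?inE//; last by move=> w [[]].
  by apply: measurableI => //; exact: msignal.
transitivity (\sum_(r : table) (F (s, h, r))%:E * ((table_prob g2 h r)%:E * Ps)).
  by apply: eq_bigr => r _; congr (_ * _); rewrite -joint -ZE.
have [p0|p0] := eqVneq (fine (P (hyp H h))) 0%R.
  have -> : Ps = 0.
    apply/eqP; rewrite eq_le measure_ge0 andbT.
    have <- : P (hyp H h) = 0 by rewrite (fin (mh h)) p0.
    by apply: le_measure; rewrite ?inE// => w [].
  by rewrite mule0 big1// => r _; rewrite !mule0.
have tot : (\sum_r table_prob g2 h r = 1)%R.
  rewrite -mulr_suml; apply: (mulIf p0); rewrite mulfVK// mul1r.
  apply: EFin_inj; rewrite -(fin (mh h)) -sumEFin.
  under eq_bigr => r _ do rewrite -(fin (mhr h r)).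
  rewrite -[RHS]mul1e -(@integral_cst _ _ _ P)//.
  rewrite (integral_partition P (fun r => mtable r adm2))//.
  by apply: eq_bigr => r _; rewrite integral_cst ?mul1e//.
have PsE : Ps = (fine Ps)%:E by exact: fin.
rewrite PsE -EFinM.
under eq_bigr => r _ do rewrite -!EFinM.
rewrite sumEFin; congr _%:E; rewrite mulrDl /mean_response mulr_suml.
rewrite -[X in (X + _)%R]mulr1 -[X in (_ * X + _)%R]tot mulr_sumr -big_split /=.
by apply: eq_bigr => r _; rewrite /F /=; ring.
Qed.

End Reduction.

(** * Dynamic programming for O1 *)

Lemma big_option (R : Type) (idx : R) (op : Monoid.com_law idx) (I : finType)
    (F : option I -> R) :
  \big[op/idx]_u F u = op (F None) (\big[op/idx]_i F (Some i)).
Proof.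
rewrite (bigD1 None) //=; congr (op _ _).
rewrite (reindex_omap Some id) => [|[]//].
by apply: eq_bigl => i; rewrite eqxx.
Qed.

Section Dynamic.
Context {R : realType} {dW d1 d2 : measure_display}.
Context {Omega : measurableType dW}.
Context {Obs1 : measurableType d1} {Obs2 : measurableType d2}.
Variables (P : probability Omega R) (H : {RV P >-> bool}).
Variables (Y1 : nat -> {RV P >-> Obs1}) (Y2 : nat -> {RV P >-> Obs2}).
Variables (mu1 : nat -> {sigma_finite_measure set Obs1 -> \bar R}).
Variables (mu2 : nat -> {sigma_finite_measure set Obs2 -> \bar R}).
Variables (f1 : nat -> bool -> Obs1 -> R) (f2 : nat -> bool -> Obs2 -> R).
Hypothesis dens1 : forall t h, (1 <= t)%N -> is_density (mu1 t) (f1 t h).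
Hypothesis indep : cond_independent_with_densities H Y1 Y2 mu1 mu2 f1 f2.
Variables (M T1 : nat).
Hypotheses (M_gt0 : (0 < M)%N) (T1_gt0 : (0 < T1)%N).
Variable pi1 : forall t, t.-tuple Obs1 -> R.
Hypothesis belief1 : forall t, (1 <= t <= T1)%N -> is_belief H Y1 (@pi1 t).
Variables (cost : nat -> 'I_M -> bool -> R) (K : R).
Hypothesis cost_bnd : forall k m h, 0 <= cost k m h <= K.

Local Notation signal := ('I_T1.+1 * 'I_M)%type.
Local Notation V k x := (value mu1 f1 T1 cost K k x (1 - x)).
Local Notation C k x := (cont mu1 f1 T1 cost K k x (1 - x)).

Definition belief k (w : Omega) : R := clip (pi1 (hist Y1 k w)).

Let belief01 k w : 0 <= belief k w <= 1. Proof. exact: clip01. Qed.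

Let mpi k : (1 <= k <= T1)%N -> measurable_fun setT (@pi1 k).
Proof. by case/belief1. Qed.

Let mclip : measurable_fun setT (@clip R).
Proof. by apply: measurable_maxr => //; exact: measurable_minr. Qed.

Let mclip_pi k : (1 <= k <= T1)%N ->
  measurable_fun setT (fun y : k.-tuple Obs1 => clip (pi1 y)).
Proof. by move=> /mpi; exact: measurableT_comp. Qed.

Let mbelief k : (1 <= k <= T1)%N -> measurable_fun setT (belief k).
Proof. by move=> /mclip_pi mk; exact: (measurableT_comp mk). Qed.

Let belief_prob k A : (1 <= k <= T1)%N -> measurable A ->
  (P (hyp H false `&` hist Y1 k @^-1` A) =
   \int[P]_(w in hist Y1 k @^-1` A) (clip (pi1 (hist Y1 k w)))%:E)%E.
Proof.
move=> kT; case: (belief1 kT) => mk kE.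
by apply: clip_belief => //; exact: measurable_hyp.
Qed.

Lemma belief_ae k : (1 <= k <= T1)%N ->
  {ae P, forall w, 0 <= pi1 (history Y1 k w) <= 1}.
Proof.
move=> kT; case: (belief1 kT) => mk kE.
exact: (belief_ae01 (measurable_hyp H false) (X := hist Y1 k)).
Qed.

Let mval W k : regular K W -> (1 <= k <= T1)%N ->
  measurable_fun setT (fun w => (W (belief k w) (1 - belief k w))%:E).
Proof.
move=> [mW _ _ _ _] kT; apply/measurable_EFinP.
apply: (measurableT_comp mW (measurable_fun_pair (mbelief kT) _)).
by apply: measurable_funB => //; exact: mbelief.
Qed.

Let mmix c k : (1 <= k <= T1)%N ->
  measurable_fun setT (fun w => (mix c (belief k w))%:E).
Proof.
move=> kT; apply/measurable_EFinP; apply: measurable_funD.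
  by apply: measurable_funM => //; exact: mbelief.
apply: measurable_funM => //; apply: measurable_funB => //; exact: mbelief.
Qed.

Let mix_ge0 (c : bool -> R) k w : (forall h, 0 <= c h) -> 0 <= mix c (belief k w).
Proof.
move=> c0; case/andP: (belief01 k w) => b0 b1.
by rewrite addr_ge0// mulr_ge0// subr_ge0.
Qed.

Let regV k : regular K (value mu1 f1 T1 cost K k).
Proof. exact: regular_value. Qed.

Let regC k : regular K (cont mu1 f1 T1 cost K k).
Proof. exact: regular_cont. Qed.

Let V_ge0 k w : 0 <= V k (belief k w). Proof. by case: (regV k). Qed.
Let C_ge0 k w : 0 <= C k (belief k w). Proof. by case: (regC k). Qed.

Let snoc k (z : k.-tuple Obs1 * Obs1) : k.+1.-tuple Obs1 :=
  [tuple if insub (i : nat) is Some j then tnth z.1 (j : 'I_k) else z.2 | i < k.+1].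

Let snoc_hist k w : snoc (hist Y1 k w, Y1 k.+1 w) = hist Y1 k.+1 w.
Proof.
apply: eq_from_tnth => i; rewrite !tnth_mktuple /=.
case: insubP => [j _ ji|]; first by rewrite tnth_mktuple ji.
rewrite -leqNgt => ki; congr (Y1 _.+1 w).
by apply/eqP; rewrite eqn_leq ki -ltnS ltn_ord.
Qed.

Let measurable_snoc k : measurable_fun setT (@snoc k).
Proof.
apply/measurable_fun_tnthP => i; case E : (insub (i : nat) : option 'I_k) => [j|].
  rewrite (_ : _ \o _ = (@tnth _ Obs1 ^~ j) \o fst).
    by apply: measurableT_comp => //; exact: measurable_tnth.
  by apply/funext => z; rewrite /= tnth_mktuple E.
rewrite (_ : _ \o _ = snd) //.
by apply/funext => z; rewrite /= tnth_mktuple E.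
Qed.

Let unsnoc k (y : k.+1.-tuple Obs1) : k.-tuple Obs1 * Obs1 :=
  (truncate (leqnSn k) y, tnth y ord_max).

Let measurable_unsnoc k : measurable_fun setT (@unsnoc k).
Proof.
by apply: measurable_fun_pair; [exact: measurable_truncate|exact: measurable_tnth].
Qed.

Local Open Scope ereal_scope.

(** Bellman's equation.  The event [E], observed by time [k], will be that O1 is
    silent up to and including time [k]. *)
Lemma belief_step k E : (1 <= k < T1)%N -> observed Y1 k E ->
  \int[P]_(w in E) (V k.+1 (belief k.+1 w))%:E =
  \int[P]_(w in E) (C k (belief k w))%:E.
Proof.
move=> /andP[k1 kT] [A mA ->].
have kT' : (1 <= k <= T1)%N by rewrite k1 ltnW.
have [mV V0 Vh _ _] := regV k.+1.
have dens h := dens1 h (ltn0Sn k).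
pose r z := clip (pi1 (snoc (k := k) z)).
have rE w : r (hist Y1 k w, Y1 k.+1 w) = belief k.+1 w.
  by rewrite /r snoc_hist.
have mr : measurable_fun setT r.
  exact: (measurableT_comp (mclip_pi _) (@measurable_snoc k)).
have step := @bayes_step R dW _ _ Omega _ _ P H (hist Y1 k) (Y1 k.+1) (mu1 k.+1)
  (f1 k.+1) (fun h => let: And3 mf _ _ := dens h in mf)
  (fun h => let: And3 _ f0 _ := dens h in f0)
  (fun y => clip (pi1 y)) r (mclip_pi kT') (fun z => clip01 _) mr
  (fun z => clip01 _) (fun B mB => belief_prob kT' mB) _
  (fun h B D mB mD => hist_next_indep dens1 indep h mB mD)
  _ mV V0 Vh _ mA.
transitivity (\int[P]_(w in hist Y1 k @^-1` A)
    (value mu1 f1 T1 cost K k.+1 (r (hist Y1 k w, Y1 k.+1 w))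
      (1 - r (hist Y1 k w, Y1 k.+1 w)))%:E).
  by apply: eq_integral => w _; rewrite rE.
rewrite step => [|B mB].
  apply: eq_integral => w _; rewrite contS//.
  case/andP: (belief01 k w) => b0 b1.
  by rewrite -(transE dens (regV k.+1) (K_ge0 cost_bnd M_gt0)) ?subr_ge0.
have preE : pair_mfun (hist Y1 k) (Y1 k.+1) @^-1` B =
    hist Y1 k.+1 @^-1` (@unsnoc k @^-1` B).
  apply/seteqP; split=> w; rewrite /= /pair_mfun /unsnoc.
    by rewrite -[history _ _ _]/(hist Y1 k.+1 w) truncate_hist tnth_mktuple.
  by rewrite -[history _ _ _]/(hist Y1 k.+1 w) truncate_hist tnth_mktuple.
rewrite preE belief_prob ?kT//; last first.
  by rewrite -[X in measurable X]setTI; exact: measurable_unsnoc.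
by apply: eq_integral => w _; rewrite -/(belief k.+1 w) -rE.
Qed.

Variable g1 : policy1 Obs1 M.
Hypothesis adm : admissible1 T1 g1.

Definition silent k : set Omega :=
  [set w | forall u, (1 <= u)%N -> (u < k)%N -> message Y1 g1 w u = None].

Local Notation stopped k m :=
  [set w | signal_of Y1 T1 M_gt0 g1 w = ((inord k : 'I_T1.+1), m)].

Let message_observed k a : observed Y1 k [set w | message Y1 g1 w k = a].
Proof. by case: adm => mg _; exists [set y | @g1 k y = a]; [exact: mg|]. Qed.

Let saturated k (Q : set Omega) :
  (forall w w', (forall u, (u <= k)%N -> message Y1 g1 w u = message Y1 g1 w' u) ->
     Q w -> Q w') -> observed Y1 k Q.
Proof.
move=> Qsat; apply: (observed_saturated
    (F := fun (i : 'I_k.+1) w => message Y1 g1 w i)).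
  by move=> i a; apply: observed_le (message_observed i a); rewrite -ltnS.
by move=> w w' eqw; apply: Qsat => u uk; exact: (eqw (Ordinal (uk : (u < k.+1)%N))).
Qed.

Let silent_observed k : observed Y1 k (silent k.+1).
Proof. by apply: saturated => w w' eqw sw u u1 uk; rewrite -eqw// sw. Qed.

Let msilent k : measurable (silent k).
Proof.
case: k => [|k]; last exact: observed_measurable (silent_observed k).
by rewrite (_ : silent 0 = setT)//; apply/seteqP; split.
Qed.

Let stoppedE k m : (1 <= k <= T1)%N ->
  stopped k m = silent k `&` [set w | message Y1 g1 w k = Some m].
Proof.
move=> /andP[k1 kT]; apply/seteqP; split=> w.
  by move=> /(signal_of_eq Y1 M_gt0 T1_gt0 w _ adm) []; rewrite /= inordK.
by move=> [sw mw]; apply/(signal_of_eq Y1 M_gt0 T1_gt0 w _ adm); rewrite /= inordK.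
Qed.

Let stopped_observed k m : (1 <= k <= T1)%N -> observed Y1 k (stopped k m).
Proof.
move=> kT; rewrite stoppedE//; apply: saturated => w w' eqw [sw mw].
by split=> [u u1 uk|/=]; rewrite -eqw// ?sw// ltnW.
Qed.

Let split_silent k (phi : Omega -> \bar R) : (1 <= k <= T1)%N ->
  measurable_fun setT phi -> (forall w, 0 <= phi w) ->
  \int[P]_(w in silent k) phi w =
  \sum_m \int[P]_(w in stopped k m) phi w + \int[P]_(w in silent k.+1) phi w.
Proof.
move=> kT mphi phi0; rewrite (integral_partition P (Z := fun w => message Y1 g1 w k))//.
  rewrite big_option /= addeC; congr (_ + _).
    by apply: eq_bigr => m _; rewrite stoppedE.
  congr (integral _ _ _); apply/seteqP; split=> [w [sw mw] u u1|w sw].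
    by rewrite ltnS leq_eqVlt => /predU1P[->//|]; exact: sw.
  split=> [u u1 uk|]; first by apply: sw => //; rewrite ltnW.
  by case/andP: kT => k1 _; exact: sw.
by move=> a; exact: observed_measurable (message_observed k a).
Qed.

Let silent_end : silent T1.+1 = set0.
Proof.
apply/seteqP; split=> // w sw; case: adm => _ /(_ (history Y1 T1 w)); apply.
exact: sw.
Qed.

Definition stage_cost (c : signal -> bool -> R) k : \bar R :=
  \sum_m \int[P]_(w in stopped k m) (mix (c (inord k, m)) (belief k w))%:E.

(** Given the history, the expected cost of stopping is the mixture of its values
    under the two hypotheses: this is the definition of the belief. *)
Lemma sum_stage_cost (c : signal -> bool -> R) : (forall s h, (0 <= c s h)%R) ->
  \sum_(s : signal) \sum_(h : bool)
    (c s h)%:E * P (hyp H h `&` [set w | signal_of Y1 T1 M_gt0 g1 w = s]) =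
  \sum_(1 <= k < T1.+1) stage_cost c k.
Proof.
move=> c0; rewrite big_add1 /= big_mkord.
transitivity (\sum_(k < T1.+1) \sum_(m < M) \sum_(h : bool) (c (k, m) h)%:E *
    P (hyp H h `&` [set w | signal_of Y1 T1 M_gt0 g1 w = (k, m)])).
  by rewrite [RHS]pair_bigA; apply: eq_bigr => -[k m] _.
rewrite big_ord_recl big1 ?add0e => [|m _]; last first.
  rewrite big1// => h _; rewrite (_ : _ `&` _ = set0) ?measure0 ?mule0//.
  by apply/seteqP; split=> // w [_ /(signal_of_eq Y1 M_gt0 T1_gt0 w _ adm) []].
apply: eq_bigr => i _; rewrite /stage_cost; apply: eq_bigr => m _.
have kT : (1 <= i.+1 <= T1)%N by rewrite /= ltn_ord.
have iE : lift ord0 i = inord i.+1 :> 'I_T1.+1.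
  by apply/val_inj; rewrite /= inordK// ltnS ltn_ord.
rewrite iE; have [A mA AE] := stopped_observed m kT.
rewrite AE big_bool /= addeC.
have wtE h : P (hyp H h `&` hist Y1 i.+1 @^-1` A) =
    \int[P]_(w in hist Y1 i.+1 @^-1` A) (wt h (belief i.+1 w))%:E.
  apply: (belief_wt (p := fun y => clip (pi1 y))) => //.
  - exact: mclip_pi.
  - by move=> z; exact: clip01.
  - by move=> B mB; exact: belief_prob.
have mXA : measurable (hist Y1 i.+1 @^-1` A) by exact: measurable_funPTI.
have mwt h : measurable_fun setT (fun w => (wt h (belief i.+1 w))%:E).
  by apply/measurable_EFinP; exact: (measurable_wt h (mbelief kT)).
have wt0 h w : 0 <= (wt h (belief i.+1 w))%:E by rewrite lee_fin wt_ge0.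
rewrite !wtE -!ge0_integralZl_EFin//; first last.
- by apply: measurable_funTS.
- by apply: measurable_funTS.
rewrite -ge0_integralD//; first last.
- by apply: measurable_funTS; apply: measurable_funeM.
- by move=> w _; rewrite mule_ge0 ?lee_fin// -lee_fin.
- by apply: measurable_funTS; apply: measurable_funeM.
- by move=> w _; rewrite mule_ge0 ?lee_fin// -lee_fin.
apply: eq_integral => w _; rewrite -!EFinM -EFinD; congr _%:E.
by rewrite /mix /=; ring.
Qed.

Let stage_value k : \bar R := \int[P]_(w in silent k) (V k (belief k w))%:E.

Let next_stage k : (1 <= k <= T1)%N ->
  \int[P]_(w in silent k.+1) (C k (belief k w))%:E = stage_value k.+1.
Proof.
move=> /andP[k1]; rewrite leq_eqVlt => /predU1P[->|kT].
  by rewrite /stage_value silent_end !integral_set0.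
by rewrite /stage_value (belief_step _ (silent_observed k))// k1.
Qed.

Let stage_value_end : stage_value T1.+1 = 0.
Proof. by rewrite /stage_value silent_end integral_set0. Qed.

Let stage_value1 : stage_value 1 = \int[P]_w (V 1 (belief 1 w))%:E.
Proof.
rewrite /stage_value (_ : silent 1 = setT)//; apply/seteqP; split=> // w _ u.
by case: u.
Qed.

Let split_value k : (1 <= k <= T1)%N -> stage_value k =
  \sum_m \int[P]_(w in stopped k m) (V k (belief k w))%:E +
  \int[P]_(w in silent k.+1) (V k (belief k w))%:E.
Proof.
move=> kT; apply: split_silent => //; first exact: mval.
by move=> w; rewrite lee_fin.
Qed.

Let mstopped k m : (1 <= k <= T1)%N -> measurable (stopped k m).
Proof. by move=> kT; exact: observed_measurable (stopped_observed m kT). Qed.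

(** Backward induction: at each stage both stopping and continuing cost at least
    the value. *)
Lemma value_le_cost (c : signal -> bool -> R) : (forall s h, (0 <= c s h)%R) ->
  (forall k m x, (1 <= k <= T1)%N -> (0 <= x <= 1)%R ->
     (V k x <= mix (c (inord k, m)) x)%R) ->
  \int[P]_w (V 1 (belief 1 w))%:E <= \sum_(1 <= k < T1.+1) stage_cost c k.
Proof.
move=> c0 Vc; rewrite -stage_value1.
suff ind n k : (T1.+1 - k = n)%N -> (1 <= k <= T1.+1)%N ->
    stage_value k <= \sum_(k <= i < T1.+1) stage_cost c i.
  by apply: (ind T1); rewrite ?subSS ?subn0.
elim: n k => [|n IH] k nE /andP[k1 kT].
  have -> : k = T1.+1 by apply/eqP; rewrite eqn_leq kT -subn_eq0 nE.
  by rewrite stage_value_end big_geq.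
have kT' : (k <= T1)%N by rewrite -ltnS -subn_gt0 nE.
have kT1 : (1 <= k <= T1)%N by rewrite k1.
rewrite split_value// big_ltn// leeD//.
  apply: lee_sum => m _; apply: ge0_le_integral => //; first exact: mstopped.
  - by move=> w _; rewrite lee_fin.
  - by apply: measurable_funTS; exact: mval.
  - by apply: measurable_funTS; exact: mmix.
  - by move=> w _; rewrite lee_fin; exact: Vc.
apply: le_trans (IH k.+1 _ _); last exact: kT'.
  rewrite -next_stage//; apply: ge0_le_integral => //.
  - by move=> w _; rewrite lee_fin.
  - by apply: measurable_funTS; exact: mval.
  - by apply: measurable_funTS; exact: mval.
  - by move=> w _; rewrite lee_fin; exact: value_cont.
by rewrite subnS nE.
Qed.

(** Backward induction again, for a policy whose action is optimal at almost every
    history. *)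
Lemma cost_le_value (c : signal -> bool -> R) : (forall s h, (0 <= c s h)%R) ->
  (forall k m, (1 <= k <= T1)%N -> {ae P, forall w, message Y1 g1 w k = Some m ->
     (mix (c (inord k, m)) (belief k w) <= V k (belief k w))%R}) ->
  (forall k, (1 <= k < T1)%N -> {ae P, forall w, message Y1 g1 w k = None ->
     (C k (belief k w) <= V k (belief k w))%R}) ->
  \sum_(1 <= k < T1.+1) stage_cost c k <= \int[P]_w (V 1 (belief 1 w))%:E.
Proof.
move=> c0 stop go; rewrite -stage_value1.
suff ind n k : (T1.+1 - k = n)%N -> (1 <= k <= T1.+1)%N ->
    \sum_(k <= i < T1.+1) stage_cost c i <= stage_value k.
  by apply: (ind T1); rewrite ?subSS ?subn0.
elim: n k => [|n IH] k nE /andP[k1 kT].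
  have -> : k = T1.+1 by apply/eqP; rewrite eqn_leq kT -subn_eq0 nE.
  by rewrite stage_value_end big_geq.
have kT' : (k <= T1)%N by rewrite -ltnS -subn_gt0 nE.
have kT1 : (1 <= k <= T1)%N by rewrite k1.
rewrite split_value// big_ltn// leeD//.
  apply: lee_sum => m _; apply: ae_ge0_le_integral => //; first exact: mstopped.
  - by move=> w _; rewrite lee_fin; exact: mix_ge0.
  - by apply: measurable_funTS; exact: mmix.
  - by move=> w _; rewrite lee_fin.
  - by apply: measurable_funTS; exact: mval.
  - apply: filterS (stop k m kT1) => w le sw; rewrite lee_fin; apply: le.
    by move: sw; rewrite stoppedE// => -[].
apply: le_trans (IH k.+1 _ _) _; [by rewrite subnS nE|exact: kT'|].
move: (kT'); rewrite leq_eqVlt => /predU1P[kE|kltT].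
  by rewrite /stage_value kE silent_end !integral_set0.
rewrite -next_stage//; apply: ae_ge0_le_integral => //.
- by move=> w _; rewrite lee_fin.
- by apply: measurable_funTS; exact: mval.
- by move=> w _; rewrite lee_fin.
- by apply: measurable_funTS; exact: mval.
- have kT2 : (1 <= k < T1)%N by rewrite k1.
  by apply: filterS (go k kT2) => w le sw; rewrite lee_fin; apply: le; exact: sw.
Qed.

End Dynamic.

(** * Optimality of threshold policies *)

Theorem theorem10 (R : realType) (dW d1 d2 : measure_display)
    (Omega : measurableType dW)
    (Obs1 : measurableType d1) (Obs2 : measurableType d2)
    (P : probability Omega R) (p0 : R) (H : {RV P >-> bool})
    (Y1 : nat -> {RV P >-> Obs1}) (Y2 : nat -> {RV P >-> Obs2})
    (mu1 : nat -> {sigma_finite_measure set Obs1 -> \bar R})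
    (mu2 : nat -> {sigma_finite_measure set Obs2 -> \bar R})
    (f1 : nat -> bool -> Obs1 -> R) (f2 : nat -> bool -> Obs2 -> R)
    (prior : P [set w | H w = false] = p0%:E)
    (dens1 : forall t h, (1 <= t)%N -> is_density (mu1 t) (f1 t h))
    (dens2 : forall t h, (1 <= t)%N -> is_density (mu2 t) (f2 t h))
    (indep : cond_independent_with_densities H Y1 Y2 mu1 mu2 f1 f2)
    (prob : problem) (M T1 T2 : nat)
    (M_gt0 : (0 < M)%N) (T1_gt0 : (0 < T1)%N)
    (T1_le_T2 : prob = P2 -> (T1 <= T2)%N)
    (c1 c2 L : R) (J : bool -> bool -> R)
    (c1_gt0 : 0 < c1) (c2_gt0 : 0 < c2)
    (J_bound : forall u h, 0 <= J u h <= L)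
    (J_01 : J true true < J false true) (J_10 : J false false < J true false)
    (pi1 : forall t, t.-tuple Obs1 -> R)
    (belief1 : forall t, (1 <= t <= T1)%N -> is_belief H Y1 (@pi1 t)) :
  forall (g1 : policy1 Obs1 M) (g2 : policy2 Obs2 M),
    admissible1 T1 g1 -> admissible2 T2 g2 ->
  exists (g1' : policy1 Obs1 M) (g2' : policy2 Obs2 M),
    [/\ admissible1 T1 g1', admissible2 T2 g2',
        threshold_policy T1 pi1 g1'
      & (expected_cost H Y1 Y2 prob T1 T2 g1' g2' c1 c2 J
         <= expected_cost H Y1 Y2 prob T1 T2 g1 g2 c1 c2 J)%E].
Proof.
move=> g1 g2 adm1 adm2.
have c1_ge0 := ltW c1_gt0; have c2_ge0 := ltW c2_gt0.
have J_ge0 u h : 0 <= J u h by case/andP: (J_bound u h).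
pose resp := mean_response H Y2 prob T2 c2 J g2 : 'I_T1.+1 * 'I_M -> bool -> R.
have resp_ge0 s h : 0 <= resp s h by exact: mean_response_ge0.
pose K := c1 * T1%:R + \sum_s \sum_h resp s h.
have cost_bnd k m h : 0 <= msg_cost c1 resp k m h <= K.
  rewrite /msg_cost /stop_cost addr_ge0 ?mulr_ge0//= lerD//.
    by rewrite ler_wpM2l// ler_nat -ltnS.
  rewrite (bigD1 (inord k, m))//= (bigD1 h)//= -addrA lerDl addr_ge0//.
    exact: sumr_ge0.
  by apply: sumr_ge0 => s _; exact: sumr_ge0.
have /choice[s_ /choice[al /choice[be plan]]] k :
    exists (s : 'I_M -> 'I_T1.+1 * 'I_M) (alpha beta : nat -> R),
    (1 <= k <= T1)%N ->
    [/\ chained (M := M) alpha beta, forall j, (k <= (s j).1)%N,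
      forall (j : 'I_M) (x : R), 0 <= x <= 1 -> alpha j <= x <= beta j ->
        mix (stop_cost c1 resp k (s j)) x <=
          value mu1 f1 T1 (msg_cost c1 resp) K k x (1 - x)
    & forall x : R, 0 <= x <= 1 -> (exists j : 'I_M, alpha j <= x <= beta j) \/
        (k < T1)%N /\ cont mu1 f1 T1 (msg_cost c1 resp) K k x (1 - x) <=
          value mu1 f1 T1 (msg_cost c1 resp) K k x (1 - x)].
  have [kT|kT] := boolP (1 <= k <= T1)%N; last first.
    by exists (fun=> (ord0, Ordinal M_gt0)), (fun=> 0), (fun=> 0).
  have [s [alpha [beta sP]]] := stage_plan dens1 M_gt0 c1_ge0 cost_bnd kT.
  by exists s, alpha, beta.
pose sigma (s : 'I_T1.+1 * 'I_M) := s_ s.1 s.2.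
have later (s : 'I_T1.+1 * 'I_M) : (s.1 <= (sigma s).1)%N.
  have [s0|s1] := posnP s.1; first by rewrite s0.
  have sT : (1 <= s.1 <= T1)%N by rewrite s1 -ltnS ltn_ord.
  by have [_ ord_plan _ _] := plan _ sT; exact: ord_plan.
have [g2' adm2' mim] := mimic_exists prob later adm2.
pose g1' : policy1 Obs1 M := fun t y =>
  if (1 <= t <= T1)%N then
    if t == T1 then final_rule M (be t) (pi1 t y)
    else stage_rule M (al t) (be t) (pi1 t y)
  else None.
have adm1' : admissible1 T1 g1'.
  split=> [t a|y]; last first.
    rewrite /g1' T1_gt0 leqnn eqxx.
    have [j [jE _ _]] := final_rule_some M_gt0 (be T1) (pi1 T1 y).
    by rewrite jE.
  rewrite /g1'; case tT : (1 <= t <= T1)%N; last first.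
    have [->|aN] := pselect (a = None).
      by rewrite (_ : [set _ | _] = setT)//; apply/seteqP; split.
    by rewrite (_ : [set _ | _] = set0)//; apply/seteqP; split=> // y /esym.
  have [mpi _] := belief1 t tT.
  case: (t == T1); rewrite -[X in measurable X]setTI.
    exact: (mpi measurableT _ (@measurable_final_rule _ M (be t) a)).
  exact: (mpi measurableT _ (@measurable_stage_rule _ M (al t) (be t) a)).
(* The right end-points of the intervals serve as the final thresholds. *)
exists g1', g2'; split=> //.
  exists (fun k => if k == T1 then be k else al k), be; split.
  - rewrite /= eqxx; have T11 : (1 <= T1 <= T1)%N by rewrite T1_gt0 leqnn.
    by have [ch _ _ _] := plan _ T11; exact: (chained_final_sorted M_gt0 ch).
  - by move=> y; rewrite /g1' T1_gt0 leqnn eqxx.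
  - move=> k /andP[k1 kT]; rewrite (ltn_eqF kT).
    have kT1 : (1 <= k <= T1)%N by rewrite k1 ltnW.
    by have [ch _ _ _] := plan _ kT1; exact: (chained_sorted M_gt0 ch).
  - by move=> k /andP[k1 kT] y; rewrite /g1' k1 (ltnW kT) (ltn_eqF kT).
pose c' (s : 'I_T1.+1 * 'I_M) h := c1 * s.1%:R + resp (sigma s) h.
pose c0 (s : 'I_T1.+1 * 'I_M) h := c1 * s.1%:R + resp s h.
have c'_ge0 s h : 0 <= c' s h by rewrite addr_ge0// mulr_ge0.
have c0_ge0 s h : 0 <= c0 s h by rewrite addr_ge0// mulr_ge0.
rewrite (expected_costE indep M_gt0 T1_gt0 c1_ge0 c2_ge0 J_ge0 adm1' adm2 mim).
have mim_id : mimics prob (T1 := T1) id g2 g2 by [].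
rewrite (expected_costE indep M_gt0 T1_gt0 c1_ge0 c2_ge0 J_ge0 adm1 adm2 mim_id).
rewrite (sum_stage_cost M_gt0 T1_gt0 belief1 adm1' c'_ge0).
rewrite (sum_stage_cost M_gt0 T1_gt0 belief1 adm1 c0_ge0).
have c'E k m : (1 <= k <= T1)%N -> c' (inord k, m) = stop_cost c1 resp k (s_ k m).
  move=> /andP[k1 kT]; apply/funext => h.
  by rewrite /c' /sigma /stop_cost /= inordK.
apply: (@le_trans _ _ (\int[P]_w (value mu1 f1 T1 (msg_cost c1 resp) K 1
    (belief Y1 pi1 1 w) (1 - belief Y1 pi1 1 w))%:E)%E).
  apply: (cost_le_value dens1 indep M_gt0 T1_gt0 belief1 cost_bnd adm1' c'_ge0).
  - move=> k m kT; apply: filterS (belief_ae belief1 kT) => w pi01.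
    have [ch _ opt cov] := plan _ kT.
    rewrite /message c'E// /belief clip_id// => g1m.
    apply: opt => //; move: g1m; rewrite /g1' kT; case: eqP => [kE|_] msg.
      have [//|[]] := cov _ pi01; last by rewrite kE ltnn.
      move=> /(final_ruleP M_gt0 ch)[j jE]; rewrite -[history _ _ _]/(hist Y1 k w) in msg.
      by move: jE; rewrite msg => -[->].
    by have := stage_ruleP M_gt0 (pi1 k (history Y1 k w)) ch; rewrite msg.
  - move=> k /andP[k1 kT]; have kT1 : (1 <= k <= T1)%N by rewrite k1 ltnW.
    apply: filterS (belief_ae belief1 kT1) => w pi01.
    have [ch _ opt cov] := plan _ kT1.
    rewrite /message /belief clip_id// /g1' kT1 (ltn_eqF kT) => msg.
    have := stage_ruleP M_gt0 (pi1 k (history Y1 k w)) ch; rewrite msg => none.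
    by have [[j jin]|[_]//] := cov _ pi01; have := none j; rewrite jin.
apply: (value_le_cost dens1 indep M_gt0 T1_gt0 belief1 cost_bnd adm1 c0_ge0).
by move=> k m x kT /andP[x0 x1]; apply: value_line; rewrite ?subr_ge0.
Qed.
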